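(* Let $n\ge 1$, let $\boldsymbol{\mu}\in\mathbb{R}^n$, let $\Sigma\in\mathbb{R}^{n\times n}$ be symmetric positive definite, and let $\mathbf{m}\sim\mathcal{N}(\boldsymbol{\mu},\Sigma)$ be a prior. Fix an index $i\in\{1,\dots,n\}$ and a measurement $y_i\in\{-1,1\}$ with Bernoulli likelihood $p(y_i\mid \mathbf{m})=\Phi(y_i m_i;0,1)$. Let $p(\mathbf{m})$ denote the posterior density, i.e. the probability density proportional to $\phi(\mathbf{m};\boldsymbol{\mu},\Sigma)\,\Phi(y_i m_i;0,1)$. Consider the following two ways of approximating $p$ by a normal density $\mathcal{N}(\hat{\boldsymbol{\mu}},\hat\Sigma)$: (1) take $(\hat{\boldsymbol{\mu}}_c,\hat\Sigma_c)$ minimizing $$\mathrm{KL}\big(\phi(\mathbf{m};\hat{\boldsymbol{\mu}}_c,\hat\Sigma_c)\,\big\|\,\phi(\mathbf{m};\boldsymbol{\mu},\Sigma)\Phi(y_i m_i;0,1)\big);$$ (2) take $(\tilde\mu_i,\tilde\sigma_i^2)$ minimizing $$\mathrm{KL}\Big(\int \phi(\mathbf{m};\boldsymbol{\mu},\Sigma)\,\phi(m_i;\tilde\mu_i,\tilde\sigma_i^2)\,\prod_{j\ne i}dm_j\;\Big\|\;\int \phi(\mathbf{m};\boldsymbol{\mu},\Sigma)\,\Phi(y_i m_i;0,1)\,\prod_{j\ne i}dm_j\Big),$$ where both arguments (functions of $m_i$) are normalized to probability densities, and then form the normal density proportional to $\phi(\mathbf{m};\boldsymbol{\mu},\Sigma)\,\phi(m_i;\tilde\mu_i,\tilde\sigma_i^2)$.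 Then the two approaches give the same result: $\phi(\mathbf{m};\hat{\boldsymbol{\mu}}_c,\hat\Sigma_c)$ is equal to the normalized density proportional to $\phi(\mathbf{m};\boldsymbol{\mu},\Sigma)\,\phi(m_i;\tilde\mu_i,\tilde\sigma_i^2)$.
   Context: $\phi(\cdot;\mathbf{a},B)$ denotes the normal probability density function with mean $\mathbf{a}$ and covariance $B$ (in one dimension, $\phi(x;a,s^2)$ with variance $s^2>0$). $\Phi(x;0,1)=\int_{-\infty}^x\phi(u;0,1)\,du$ is the standard normal cumulative distribution function (probit function). $\mathrm{KL}(p\|q)=\int p(x)\log\big(p(x)/q(x)\big)\,dx$ is the Kullback–Leibler divergence. $m_i$ denotes the $i$-th coordinate of $\mathbf{m}$. Normalization constants of the densities are ignored, i.e. all densities in the KL divergences are taken normalized. *)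

(* Defs.v *)
From HB Require Import structures.
From mathcomp Require Import all_boot all_order all_algebra.
From mathcomp Require Import all_classical all_reals all_analysis.
Set Implicit Arguments. Unset Strict Implicit. Unset Printing Implicit Defensive.
Import Order.TTheory GRing.Theory Num.Theory.
Local Open Scope ring_scope.

Section Defs.
Variable R : realType.

Definition vcons (k : nat) (x : R) (v : 'rV[R]_k) : 'rV[R]_k.+1 :=
  \row_j (if unlift ord0 j is Some l then v 0 l else x).

(* Lebesgue integral over R^n, computed as iterated one-dimensional
   Lebesgue integrals (extended-real valued) *)
Fixpoint iint (n : nat) : ('rV[R]_n -> \bar R) -> \bar R :=
  match n return ('rV[R]_n -> \bar R) -> \bar R with
  | 0 => fun f => f 0
  | k.+1 => fun f =>
      (\int[@lebesgue_measure R]_x iint (fun v : 'rV[R]_k => f (vcons x v)))%E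
  end.

Definition vins (n : nat) (i : 'I_n) (t : R) (v : 'rV[R]_n.-1) : 'rV[R]_n :=
  \row_j (if unlift i j is Some l then v 0 l else t).

Definition marg (n : nat) (i : 'I_n) (g : 'rV[R]_n -> R) (t : R) : R :=
  fine (iint (fun v : 'rV[R]_n.-1 => (g (vins i t v))%:E)).

Definition spd (n : nat) (S : 'M[R]_n) : Prop :=
  S^T = S /\ forall v : 'rV[R]_n, v != 0 -> 0 < (v *m S *m v^T) 0 0.

Definition mvn_pdf (n : nat) (a : 'rV[R]_n) (B : 'M[R]_n) (m : 'rV[R]_n) : R :=
  (Num.sqrt ((pi *+ 2) ^+ n * \det B))^-1 *
  expR (- ((m - a) *m invmx B *m (m - a)^T) 0 0 / 2).

Definition std_normal_cdf (x : R) : R :=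
  fine (\int[@lebesgue_measure R]_(u in `]-oo, x]) (normal_pdf 0 1 u)%:E)%E.

Definition normalize (n : nat) (f : 'rV[R]_n -> R) : 'rV[R]_n -> R :=
  fun m => f m / fine (iint (fun m => (f m)%:E)).
Definition normalize1 (f : R -> R) : R -> R :=
  fun t => f t / fine (\int[@lebesgue_measure R]_u (f u)%:E)%E.

Definition KL (n : nat) (p q : 'rV[R]_n -> R) : \bar R :=
  iint (fun m => (p m * ln (p m / q m))%:E).
Definition KL1 (p q : R -> R) : \bar R :=
  (\int[@lebesgue_measure R]_t (p t * ln (p t / q t))%:E)%E.

End Defs.

(* Main.v *)
(* With the mean and the variance of the [i]-th marginal fixed, the inequality
   [ln det X <= tr X - n], strict unless [X = 1], shows that the divergence to the
   posterior is least when the prior conditional law of the other coordinates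
   given the [i]-th is kept: the optimum is a rank-one tilt of the prior. Along these
   tilts the divergence is, up to a constant, the one-dimensional objective
     - ln t + (((a - mu_i) / s)^2 + (t / s)^2) / 2 - E ln Phi (y (a + t Z)),
   [s^2 = Sigma_ii], which is also the objective of the second approach, where
   however only [t < s] is attainable. As [Phi] is log-concave, this objective is
   strictly (midpoint) convex, hence its minimizer over the open strip [t < s]
   coincides with its minimizer over [t > 0]. *)
Require Import Defs.
From HB Require Import structures.
From mathcomp Require Import all_boot all_order all_algebra.
From mathcomp Require Import all_classical all_reals all_analysis.
From mathcomp Require Import measurable_realfun ring lra.
Set Implicit Arguments. Unset Strict Implicit. Unset Printing Implicit Defensive.
Import Order.TTheory GRing.Theory Num.Theory.
Import numFieldNormedType.Exports.
Local Open Scope classical_set_scope.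
Local Open Scope ring_scope.

(** * One-dimensional Gaussian expectations *)

(** A Gaussian factor in [m_i] adds its precision to that of the prior marginal, so the second
    approach reaches exactly the variances below [Sigma_ii]; this is the origin of the strip
    [t < s]. Both minimizers are given, so what has to be shown is uniqueness across the two
    domains, and midpoint convexity suffices for it: neither derivatives of the objective nor
    stationarity equations enter. [iint] integrates in a fixed order of the coordinates, and this
    shapes the computation: Gaussian integrals are reduced to standard ones by lower triangular
    factors, which respect that order, while the marginal of an arbitrary coordinate comes from
    splitting the density into a function of [m_i] and one of the residual. The divergence integrand
    is signed, so expectations are carried as statements that include integrability; for the
    likelihood term this rests on the at most quadratic growth of [- ln Phi]. *)

Section OneDim.
Context {R : realType}.
Local Notation leb := (@lebesgue_measure R).
Local Notation phi := (@normal_pdf R 0 1).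
Implicit Types (f g F G : R -> R).

Lemma measurable_affine (b c : R) : measurable_fun setT (fun x : R => b + c * x).
Proof. by apply: measurable_funD => //; apply: measurable_funM. Qed.

(** The image of Lebesgue measure under [x |-> b + c * x], scaled by [c], agrees with Lebesgue
    measure on half-open intervals, hence on all measurable sets. *)
Lemma integral_affine (f : R -> \bar R) (b c : R) : 0 < c ->
  measurable_fun setT f -> (forall x, (0 <= f x)%E) ->
  (\int[leb]_x f x = c%:E * \int[leb]_x f (b + c * x)%R)%E.
Proof.
move=> c0 mf f0.
have mT := measurable_affine b c.
pose k : {nonneg R} := NngNum (ltW c0).
pose T : R -> measurableTypeR R := fun x => b + c * x.
have mT' : measurable_fun setT T by exact: mT.
have E A : measurable A -> leb A = (c%:E * leb (T @^-1` A)%classic)%E.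
  apply: (@lebesgue_measure_unique _ (mscale k (pushforward leb T))) => //.
  move=> _ [[u v]] _ <-; rewrite [RHS]/(c%:E * leb (T @^-1` _)%classic)%E.
  have -> : (T @^-1` `]u, v]%classic)%classic
      = `](u - b) / c, (v - b) / c]%classic.
    apply/seteqP; split=> x /=; rewrite !in_itv /= ltr_pdivrMr// ler_pdivlMr//.
      by rewrite /T => /andP[? ?]; apply/andP; split; lra.
    by rewrite /T => /andP[? ?]; apply/andP; split; lra.
  have M p q : leb `]p, q]%classic = if p < q then (q - p)%:E else 0%E.
    by rewrite lebesgue_measure_itv /= lte_fin.
  rewrite !M ltr_pM2r ?invr_gt0// ltrD2r.
  case: ifP => _ /=; last by rewrite mulr0.
  by congr EFin; field; rewrite gt_eqF.
rewrite (eq_measure_integral (mscale k (pushforward leb T)))//; last first.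
  by move=> A mA _; exact: E.
rewrite ge0_integral_mscale//=.
by rewrite ge0_integral_pushforward// preimage_setT.
Qed.

(** Integrability is bundled with the value because integrals of signed functions add only when they
    are integrable; [E1] alone, defined through [fine], carries no such information. *)
Definition hasE1 G (e : R) : Prop :=
  leb.-integrable setT (fun x => (phi x * G x)%:E) /\
  (\int[leb]_x (phi x * G x)%:E = e%:E)%E.

Definition E1 G : R := fine (\int[leb]_x (phi x * G x)%:E)%E.

Lemma hasE1_E1 G e : hasE1 G e -> E1 G = e.
Proof. by case=> _; rewrite /E1 => ->. Qed.

Lemma hasE1_cst c : hasE1 (fun=> c) c.
Proof.
rewrite /hasE1; under eq_fun do rewrite mulrC EFinM.
have I := @integrable_normal_pdf R 0 1.
split; first exact: integrableZl.
by rewrite integralZl// integral_normal_pdf mule1.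
Qed.

Lemma hasE1D F e G e' : hasE1 F e -> hasE1 G e' ->
  hasE1 (fun x => F x + G x) (e + e').
Proof.
move=> [i1 h1] [i2 h2]; rewrite /hasE1.
under eq_fun do rewrite mulrDr EFinD.
split; first exact: integrableD.
by rewrite integralD// h1 h2.
Qed.

Lemma hasE1Z k F e : hasE1 F e -> hasE1 (fun x => k * F x) (k * e).
Proof.
move=> [i1 h1]; rewrite /hasE1.
under eq_fun do rewrite mulrCA EFinM.
split; first exact: integrableZl.
by rewrite integralZl// h1.
Qed.

Lemma eq_hasE1 F G e : F =1 G -> hasE1 F e -> hasE1 G e.
Proof. by move=> /funext ->. Qed.

Lemma hasE1_le F e G e' : hasE1 F e -> hasE1 G e' -> (forall x, F x <= G x) ->
  e <= e'.
Proof.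
move=> [i1 h1] [i2 h2] FG; rewrite -lee_fin -h1 -h2.
apply: le_integral => // x _; rewrite lee_fin ler_wpM2l//; exact: normal_pdf_ge0.
Qed.

Lemma hasE1_dom F G e : measurable_fun setT F -> hasE1 G e ->
  (forall x, `|F x| <= G x) -> hasE1 F (E1 F).
Proof.
move=> mF [iG _] FG.
have I : leb.-integrable setT (fun x => (phi x * F x)%:E).
  apply: le_integrable iG => //.
    apply/measurable_EFinP/measurable_funM => //; exact: measurable_normal_pdf.
  move=> x _ /=; rewrite lee_fin !normrM ler_wpM2l//.
  by rewrite (le_trans (FG x)) ?ler_norm.
by split=> //; rewrite /E1 fineK//; exact: integrable_fin_num.
Qed.

Lemma hasE1_ge0 F e : measurable_fun setT F -> (forall x, 0 <= F x) ->
  (\int[leb]_x (phi x * F x)%:E = e%:E)%E -> hasE1 F e.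
Proof.
move=> mF F0 h; split=> //; apply/integrableP; split.
  apply/measurable_EFinP/measurable_funM => //; exact: measurable_normal_pdf.
under eq_integral => x _ do rewrite /= ger0_norm ?mulr_ge0 ?normal_pdf_ge0//.
by rewrite h ltry.
Qed.

Lemma phiE x : phi x = (Num.sqrt (pi *+ 2))^-1 * expR (- x ^+ 2 / 2).
Proof.
by rewrite normal_pdfE ?oner_neq0// /normal_peak /normal_fun expr1n mul1r subr0.
Qed.

Lemma phi_gt0 x : 0 < phi x.
Proof. by rewrite phiE mulr_gt0 ?expR_gt0 // invr_gt0 sqrtr_gt0 pmulrn_lgt0 ?pi_gt0. Qed.

Lemma normal_pdfE_phi m s x : 0 < s -> normal_pdf m s x = s^-1 * phi ((x - m) / s).
Proof.
move=> s0; rewrite normal_pdfE ?gt_eqF// phiE /normal_peak /normal_fun.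
rewrite -mulrnAr sqrtrM ?sqr_ge0// sqrtr_sqr gtr0_norm// invfM mulrA.
by congr (_ * expR _); field; rewrite gt_eqF.
Qed.

Lemma phiN x : phi (- x) = phi x.
Proof. by rewrite !phiE sqrrN. Qed.

Lemma integral_phi_gauss (f : R -> R) (b c : R) : 0 < c ->
  measurable_fun setT f -> (forall x, 0 <= f x) ->
  (\int[leb]_x (normal_pdf b c x * f x)%:E = \int[leb]_x (phi x * f (b + c * x))%:E)%E.
Proof.
move=> c0 mf f0.
have c1 : c != 0 by rewrite gt_eqF.
rewrite (@integral_affine _ b c)//; first last.
- by move=> x; rewrite lee_fin mulr_ge0 ?normal_pdf_ge0.
- apply/measurable_EFinP/measurable_funM => //; exact: measurable_normal_pdf.
have mg : measurable_fun setT (fun x => phi x * f (b + c * x)).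
  apply/measurable_funM; first exact: measurable_normal_pdf.
  by apply: measurableT_comp => //; exact: measurable_affine.
rewrite -ge0_integralZl//; first last.
- exact: ltW.
- by move=> x _; rewrite lee_fin mulr_ge0 ?normal_pdf_ge0.
- apply/measurable_EFinP/measurable_funM; first by
    apply: measurableT_comp; [exact: measurable_normal_pdf| exact: measurable_affine].
  by apply: measurableT_comp => //; exact: measurable_affine.
apply: eq_integral => x _; rewrite -EFinM normal_pdfE_phi// -mulrA mulVKf//.
by congr (phi _ * _)%:E; field.
Qed.

End OneDim.

(** * Positivity, symmetry and second moment of the standard normal law *)

Section Moments.
Context {R : realType}.
Local Notation leb := (@lebesgue_measure R).
Local Notation phi := (@normal_pdf R 0 1).
Implicit Types (f g F G : R -> R).

(** A zero expectation would make the positive integrand vanish almost everywhere, although [[0, 1]]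
    has measure one. *)
Lemma hasE1_gt0 F e : hasE1 F e -> (forall x, 0 < F x) -> 0 < e.
Proof.
move=> hF F0.
have e0 : 0 <= e.
  apply: (hasE1_le (hasE1_cst 0) hF) => x; exact: ltW.
rewrite lt_neqAle e0 andbT; apply/eqP => ee.
case: hF => iF; rewrite -ee => h.
have : ae_eq leb setT (fun x => (phi x * F x)%:E) (cst 0%E).
  apply/ae_eq_integral_abs => //; first exact: (measurable_int leb).
  by under eq_integral => x _ do
    rewrite gee0_abs ?lee_fin ?mulr_ge0 ?normal_pdf_ge0 ?ltW//.
case=> N [mN N0 sub].
have IN : (`[0, 1]%classic `<=` N)%classic.
  move=> x _; apply: sub => /= /(_ I) /eqP.
  by rewrite eqe mulf_eq0 !gt_eqF ?phi_gt0.
have : (leb `[0%R, 1%R]%classic <= leb N)%E by apply: le_measure; rewrite ?inE.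
rewrite [leb N]N0 lebesgue_measure_itv /= lte_fin ltr01 -EFinB subr0.
by rewrite lee_fin ler10.
Qed.

Lemma integral_opp (f : R -> \bar R) : measurable_fun setT f ->
  (forall x, (0 <= f x)%E) -> (\int[leb]_x f x = \int[leb]_x f (- x)%R)%E.
Proof.
move=> mf f0.
pose T : R -> measurableTypeR R := -%R.
have mT : measurable_fun setT T by exact: measurable_funN.
rewrite (eq_measure_integral (pushforward leb T))//; last first.
  by move=> A mA _; exact/esym/lebesgue_measureN.
by rewrite ge0_integral_pushforward// preimage_setT.
Qed.

Lemma hasE1_opp F e : measurable_fun setT F -> (forall x, 0 <= F x) ->
  hasE1 F e -> hasE1 (fun x => F (- x)) e.
Proof.
move=> mF F0 [_ h]; apply: hasE1_ge0 => //.
  by apply: measurableT_comp => //; exact: measurable_funN.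
rewrite -h integral_opp//.
- by under eq_integral do rewrite phiN opprK.
- apply/measurable_EFinP/measurable_funM => //; first exact: measurable_normal_pdf.
  by apply: measurableT_comp => //; exact: measurable_funN.
- by move=> x; rewrite lee_fin mulr_ge0 ?normal_pdf_ge0.
Qed.

Lemma is_derive_phi (x : R) : is_derive x 1 phi (- x * phi x).
Proof.
pose k : R := (Num.sqrt (pi *+ 2))^-1.
have E : phi = fun x => k * expR (- x ^+ 2 / 2) by apply/funext => ?; rewrite phiE.
rewrite [X in is_derive _ _ X]E; apply: is_derive_eq; rewrite E /GRing.scale /=.
by field.
Qed.

Lemma is_derive_xphi (x : R) : is_derive x 1 (fun x => x * phi x) ((1 - x ^+ 2) * phi x).
Proof.
have h := is_derive_phi x.
by apply: is_derive_eq; rewrite /GRing.scale /=; ring.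
Qed.

Lemma continuous_phi : continuous phi.
Proof. by apply: continuous_normal_pdf; rewrite oner_neq0. Qed.

Lemma continuous_xphi : continuous (fun x : R => x * phi x).
Proof. by move=> x; apply: cvgM; [exact: cvg_id|exact: continuous_phi]. Qed.

Lemma cvg_xphi : x * phi x @[x --> +oo] --> (0 : R).
Proof.
pose k := (Num.sqrt (pi *+ 2 : R))^-1.
have k0 : 0 < k by rewrite invr_gt0 sqrtr_gt0 pmulrn_lgt0 ?pi_gt0.
(* The upper bound comes from [expR (x ^+ 2 / 2) >= 1 + x ^+ 2 / 2]. *)
apply: (@squeeze_cvgr _ _ _ _ (fun=> 0) (fun x : R => 2 * k * x^-1)).
- near=> x.
  have x0 : 0 < x by near: x; exact: nbhs_pinfty_gt.
  rewrite mulr_ge0 ?normal_pdf_ge0 ?ltW//= phiE -/k.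
  rewrite mulrCA (_ : 2 * k * x^-1 = k * (2 * x^-1)); last by ring.
  rewrite ltr_pM2l//.
  rewrite ltr_pdivlMr// mulNr expRN.
  rewrite mulrAC -expr2 ltr_pdivrMr ?expR_gt0//.
  have := expR_ge1Dx (x ^+ 2 / 2); lra.
- exact: cvg_cst.
- rewrite -[X in _ --> X](mulr0 (2 * k)); apply: cvgM; first exact: cvg_cst.
  by apply/gtr0_cvgV0; [near=> x; near: x; exact: nbhs_pinfty_gt|exact: cvg_id].
Unshelve. all: by end_near. Qed.

Lemma derive1_xphi (x : R) : (fun x : R => x * phi x)^`()%classic x = (1 - x ^+ 2) * phi x.
Proof. by have h := is_derive_xphi x; rewrite derive1E derive_val. Qed.

(** [x * phi x] is an antiderivative of [(1 - x ^+ 2) * phi x]. The half-line is cut at [1], where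
    this derivative changes sign, so that all integrals involved are of nonnegative functions; the
    boundary terms [phi 1] of the two pieces cancel in [hasE1_sqr]. *)
Lemma integral_sqr_phi01 :
  (\int[leb]_(x in `[0%R, 1%R]) (phi x)%:E =
   \int[leb]_(x in `[0%R, 1%R]) (phi x * x ^+ 2)%:E + (phi 1)%:E)%E.
Proof.
have mphi := @measurable_normal_pdf R 0 1.
have c2 : continuous (fun x : R => (1 - x ^+ 2) * phi x).
  move=> x; apply: cvgM; last exact: continuous_phi.
  by apply: cvgB; [exact: cvg_cst|exact: exprn_continuous].
have -> : (phi 1)%:E = (\int[leb]_(x in `[0%R, 1%R]) ((1 - x ^+ 2) * phi x)%:E)%E.
  rewrite (@continuous_FTC2 _ _ (fun x => x * phi x))//.
  - by rewrite mul1r mul0r sube0.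
  - exact: continuous_subspaceT.
  - split.
    + by move=> x _; case: (is_derive_xphi x).
    + apply: cvg_at_right_filter; exact: continuous_xphi.
    + apply: cvg_at_left_filter; exact: continuous_xphi.
  - by move=> x _; exact: derive1_xphi.
rewrite -ge0_integralD//=.
- by apply: eq_integral => x _; rewrite -EFinD; congr EFin; ring.
- by move=> x _; rewrite lee_fin mulr_ge0 ?normal_pdf_ge0 ?sqr_ge0.
- by apply/measurable_EFinP/measurable_funTS/measurable_funM => //; exact: measurable_funX.
- move=> x; rewrite /= in_itv /= => /andP[x0 x1].
  rewrite lee_fin mulr_ge0 ?normal_pdf_ge0 // subr_ge0.
  by rewrite expr_le1.
- apply/measurable_EFinP/measurable_funTS; exact: continuous_measurable_fun.
Qed.

Lemma integral_sqr_phi1y :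
  (\int[leb]_(x in `[1%R, +oo[) (phi x * x ^+ 2)%:E =
   \int[leb]_(x in `[1%R, +oo[) (phi x)%:E + (phi 1)%:E)%E.
Proof.
have mphi := @measurable_normal_pdf R 0 1.
have c2 : continuous (fun x : R => (x ^+ 2 - 1) * phi x).
  move=> x; apply: cvgM; last exact: continuous_phi.
  by apply: cvgB; [exact: exprn_continuous|exact: cvg_cst].
have pos (x : R) : 1 <= x -> 0 <= (x ^+ 2 - 1) * phi x.
  by move=> x1; rewrite mulr_ge0 ?normal_pdf_ge0 // subr_ge0 expr_ge1// (le_trans _ x1).
have -> : (phi 1)%:E = (\int[leb]_(x in `[1%R, +oo[) ((x ^+ 2 - 1) * phi x)%:E)%E.
  rewrite (@ge0_continuous_FTC2y _ _ (fun x => - (x * phi x)) _ 0)//.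
  - by rewrite mul1r sub0e EFinN oppeK.
  - exact: continuous_subspaceT.
  - by have := cvgN cvg_xphi; rewrite oppr0; apply.
  - by move=> x _; apply: derivableN; case: (is_derive_xphi x).
  - by apply: cvg_at_right_filter; apply: cvgN; exact: continuous_xphi.
  - move=> x _; have h := is_derive_xphi x.
    rewrite derive1E (@deriveN _ _ _ (fun x : R => x * phi x))//.
    by rewrite -derive1E derive1_xphi -mulNr opprB.
rewrite -ge0_integralD//=.
- by apply: eq_integral => x _; rewrite -EFinD; congr EFin; ring.
- by move=> x _; rewrite lee_fin normal_pdf_ge0.
- by apply/measurable_EFinP/measurable_funTS.
- by move=> x; rewrite /= in_itv /= andbT => x1; rewrite lee_fin pos.
- apply/measurable_EFinP/measurable_funTS; exact: continuous_measurable_fun.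
Qed.

Lemma hasE1_sqr : hasE1 (fun x : R => x ^+ 2) 1.
Proof.
have mphi := @measurable_normal_pdf R 0 1.
have cS : continuous (fun x : R => phi x * x ^+ 2).
  move=> x; apply: cvgM; [exact: continuous_phi|exact: exprn_continuous].
apply: hasE1_ge0; first exact: measurable_funX.
  by move=> x; exact: sqr_ge0.
rewrite -(@integral_normal_pdf R 0 1).
rewrite ge0_symfun_integralT//; first last.
- by move=> x /=; rewrite phiN sqrrN.
- by move=> x; rewrite mulr_ge0 ?normal_pdf_ge0 ?sqr_ge0.
rewrite ge0_symfun_integralT//; first last.
- by move=> x /=; rewrite phiN.
- exact: continuous_phi.
- by move=> x; rewrite normal_pdf_ge0.
congr (_ * _)%E.
have -> : [set x : R | 0 <= x]%classic = (`[0, 1] `|` `]1, +oo[)%classic.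
  rewrite -itv_bndbnd_setU// ?bnd_simp//.
  by rewrite set_itvcy.
have disj : [disjoint `[0, 1]%classic & `]1, +oo[%classic : set R].
  apply/disj_setPS => x [] /=; rewrite !in_itv /= andbT => /andP[_ x1].
  by rewrite ltNge x1.
rewrite !ge0_integral_setU//=; first last.
- by move=> x _; rewrite lee_fin mulr_ge0 ?normal_pdf_ge0 ?sqr_ge0.
- apply/measurable_EFinP/measurable_funTS; exact: continuous_measurable_fun.
- by move=> x _; rewrite lee_fin normal_pdf_ge0.
- by apply/measurable_EFinP/measurable_funTS.
rewrite !integral_itv_obnd_cbnd; try
  by apply/measurable_EFinP/measurable_funTS;
     first [exact: mphi|exact: continuous_measurable_fun].
by rewrite integral_sqr_phi01 integral_sqr_phi1y [RHS]addeAC [LHS]addeA.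
Qed.

End Moments.

(** * Iterated Gaussian expectations *)

Section Tame.
Context {R : realType}.
Local Notation leb := (@lebesgue_measure R).
Local Notation phi := (@normal_pdf R 0 1).
Implicit Types (f g F G : R -> R).

(** Reflection is available for nonnegative functions, so it is applied to [(x + 1) ^+ 2]: this and
    its mirror image have equal expectations and add up to [2 * (x ^+ 2 + 1)]. Then [x] is half of
    [(x + 1) ^+ 2 - (x ^+ 2 + 1)]. *)
Lemma hasE1_id : hasE1 (fun x : R => x) 0.
Proof.
have m1 : measurable_fun setT (fun x : R => (x + 1) ^+ 2).
  by apply: measurable_funX; apply: measurable_funD.
have p1 (x : R) : 0 <= (x + 1) ^+ 2 by rewrite sqr_ge0.
have h1 : hasE1 (fun x : R => (x + 1) ^+ 2) (E1 (fun x : R => (x + 1) ^+ 2)).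
  apply: (hasE1_dom m1 (hasE1Z 2 (hasE1D hasE1_sqr (hasE1_cst 1)))).
  by move=> x; rewrite ger0_norm//; have := sqr_ge0 (x - 1); lra.
set e := E1 _ in h1.
have h2 := hasE1D h1 (hasE1_opp m1 p1 h1).
have h3 : hasE1 (fun x : R => (x + 1) ^+ 2 + (- x + 1) ^+ 2) (2 * (1 + 1)).
  apply: eq_hasE1 (hasE1Z 2 (hasE1D hasE1_sqr (hasE1_cst 1))) => x; ring.
have ee : e = 2 by have := hasE1_E1 h2; rewrite (hasE1_E1 h3); lra.
have := hasE1Z 2^-1 (hasE1D h1 (hasE1Z (-1) (hasE1D hasE1_sqr (hasE1_cst 1)))).
rewrite (_ : 2^-1 * _ = 0); last by rewrite ee; lra.
by apply: eq_hasE1 => x; field.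
Qed.

(** A class containing squares, [Phi] and [- ln Phi]: the growth bound gives integrability under
    every normal law, and nonnegativity permits Tonelli. *)
Definition tame g := [/\ measurable_fun setT g, forall x, 0 <= g x &
  exists C, forall x, g x <= C * (1 + x ^+ 2)].

Lemma tame_sqr : tame (fun x : R => x ^+ 2).
Proof.
split; [exact: measurable_funX|by move=> x; exact: sqr_ge0|].
by exists 1 => x; lra.
Qed.

Lemma tame_affine g b s : tame g ->
  hasE1 (fun x => g (b + s * x)) (E1 (fun x => g (b + s * x))).
Proof.
move=> [mg g0 [C hC]].
have C0 : 0 <= C by have := le_trans (g0 0) (hC 0); rewrite expr0n addr0 mulr1.
have mg' : measurable_fun setT (fun x => g (b + s * x)).
  by apply: measurableT_comp => //; exact: measurable_affine.
(* The dominating function uses [(b + s * x) ^+ 2 <= 2 * b ^+ 2 + 2 * s ^+ 2 * x ^+ 2]. *)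
apply: (hasE1_dom mg' (hasE1Z C
  (hasE1D (hasE1_cst (1 + 2 * b ^+ 2)) (hasE1Z (2 * s ^+ 2) hasE1_sqr)))).
move=> x; rewrite ger0_norm// (le_trans (hC _))// ler_wpM2l//.
by have := sqr_ge0 (b - s * x); lra.
Qed.

Lemma E1_sqr (b s : R) : E1 (fun x => (b + s * x) ^+ 2) = b ^+ 2 + s ^+ 2.
Proof.
apply: hasE1_E1.
have := hasE1D (hasE1_cst (b ^+ 2)) (hasE1D (hasE1Z (2 * b * s) hasE1_id)
  (hasE1Z (s ^+ 2) hasE1_sqr)).
rewrite mulr0 add0r mulr1.
by apply: eq_hasE1 => x; ring.
Qed.

(** Completing the square: the joint density of [X] and [U = b + c X + d W], with [X] and [W]
    independent standard normal, is the density of [U] times the conditional density of [X] given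
    [U = u]. *)
Lemma phi_conv (b c d s x u : R) : 0 < d -> 0 < s -> s ^+ 2 = c ^+ 2 + d ^+ 2 ->
  phi x * normal_pdf (b + c * x) d u =
  normal_pdf b s u * normal_pdf (c * (u - b) / s ^+ 2) (d / s) x.
Proof.
move=> d0 s0 sE; rewrite (normal_pdfE_phi _ u d0) (normal_pdfE_phi b u s0).
rewrite (normal_pdfE_phi _ x (divr_gt0 d0 s0)) !phiE.
have dn : d != 0 by rewrite gt_eqF.
have sn : s != 0 by rewrite gt_eqF.
set k := (Num.sqrt _)^-1.
transitivity (d^-1 * k * k * (expR (- x ^+ 2 / 2) * expR (- ((u - (b + c * x)) / d) ^+ 2 / 2))).
  by ring.
transitivity (d^-1 * k * k * (expR (- ((u - b) / s) ^+ 2 / 2) *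
    expR (- ((x - c * (u - b) / s ^+ 2) / (d / s)) ^+ 2 / 2))); last first.
  by field; rewrite dn sn.
rewrite -!expRD; congr (_ * expR _); apply/eqP; rewrite -subr_eq0; apply/eqP.
rewrite (_ : u - (b + c * x) = (u - b) - c * x); last by ring.
move: (u - b) => v.
rewrite (_ : (x - c * v / s ^+ 2) / (d / s) = (x * s - c * v / s) / d); last first.
  by field; rewrite dn sn.
transitivity ((s ^+ 2 - (c ^+ 2 + d ^+ 2)) * (x ^+ 2 * s ^+ 2 - v ^+ 2) /
  (s ^+ 2 * d ^+ 2) / 2).
  by field; rewrite sn dn.
by rewrite sE subrr !mul0r.
Qed.

(** Sums of independent normal variables are normal. After the substitution [u = b + c x + d w],
    Tonelli exchanges [x] and [u], and the conditional density of [phi_conv] integrates to one. *)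
Lemma gauss_conv g b c d : tame g -> 0 <= d ->
  hasE1 (fun x => E1 (fun w => g (b + c * x + d * w)))
        (E1 (fun x => g (b + Num.sqrt (c ^+ 2 + d ^+ 2) * x))).
Proof.
(* For [d = 0] the inner law is a point mass without density; the square root is then the absolute
   value of [c], and a reflection settles negative [c]. *)
move=> tg; rewrite le_eqVlt => /predU1P[<-|d0].
  have -> : (fun x => E1 (fun w => g (b + c * x + 0 * w))) = fun x => g (b + c * x).
    apply/funext => x; apply: hasE1_E1; apply: eq_hasE1 (hasE1_cst _) => w.
    by rewrite mul0r addr0.
  rewrite expr0n addr0 sqrtr_sqr; have [c0|c0] := ler0P c; last exact: tame_affine.
  have [mg g0 _] := tg.
  have := @hasE1_opp _ _ _ _ _ (tame_affine b (- c) tg).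
  move=> /(_ (measurableT_comp mg (measurable_affine _ _)) (fun=> g0 _)).
  by apply: eq_hasE1 => x; rewrite mulrNN.
set s := Num.sqrt _.
have s0 : 0 < s by rewrite sqrtr_gt0 ltr_wpDl ?sqr_ge0 ?exprn_gt0.
have sE : s ^+ 2 = c ^+ 2 + d ^+ 2 by rewrite sqr_sqrtr// addr_ge0 ?sqr_ge0.
have [mg g0 _] := tg.
have mphi := @measurable_normal_pdf R 0 1.
have inner x : (\int[leb]_w (phi w * g (b + c * x + d * w))%:E)%E =
    (E1 (fun w => g (b + c * x + d * w)))%:E.
  by case: (tame_affine (b + c * x) d tg).
pose h (p : R * R) : \bar R := (phi p.1 * normal_pdf (b + c * p.1) d p.2 * g p.2)%:E.
have mh : measurable_fun setT h.
  apply/measurable_EFinP; apply: measurable_funM; last first.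
    by apply: measurableT_comp => //; exact: measurable_snd.
  apply: measurable_funM; first by
    apply: measurableT_comp => //; exact: measurable_fst.
  under eq_fun do rewrite (normal_pdfE_phi _ _ d0).
  apply: measurable_funM => //; apply: measurableT_comp => //.
  apply: measurable_funM => //; apply: measurable_funB; first exact: measurable_snd.
  apply: measurable_funD => //; apply: measurable_funM => //; exact: measurable_fst.
have h0 p : (0 <= h p)%E by rewrite lee_fin !mulr_ge0 ?normal_pdf_ge0.
have e1 x : (phi x * E1 (fun w => g (b + c * x + d * w)))%:E =
    (\int[leb]_u h (x, u))%E.
  rewrite EFinM -inner -integral_phi_gauss// -ge0_integralZl//.
  - by apply: eq_integral => u _; rewrite /h -EFinM mulrA.
  - apply/measurable_EFinP/measurable_funM => //; exact: measurable_normal_pdf.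
  - by move=> u _; rewrite lee_fin mulr_ge0 ?normal_pdf_ge0.
  - by rewrite lee_fin normal_pdf_ge0.
have tot : (\int[leb]_x (phi x * E1 (fun w => g (b + c * x + d * w)))%:E =
    (E1 (fun x => g (b + s * x)))%:E)%E.
  under eq_integral do rewrite e1.
  rewrite (@fubini_tonelli _ _ _ _ _ leb leb h)//.
  case: (tame_affine b s tg) => _ <-; rewrite -integral_phi_gauss//.
  apply: eq_integral => u _.
  rewrite /h /=.
  under eq_integral => x _ do rewrite (phi_conv _ _ _ d0 s0 sE) mulrAC EFinM.
  rewrite ge0_integralZl//.
  - by rewrite integral_normal_pdf mule1.
  - by apply/measurable_EFinP; exact: measurable_normal_pdf.
  - by move=> x _; rewrite lee_fin normal_pdf_ge0.
  - by rewrite lee_fin mulr_ge0 ?normal_pdf_ge0.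
apply: hasE1_ge0 => //; last first.
  move=> x; rewrite /E1 fine_ge0// integral_ge0// => w _.
  by rewrite lee_fin mulr_ge0 ?normal_pdf_ge0.
(* The inner expectation is measurable in [x] as a partial integral in Tonelli's theorem. *)
pose h' (p : R * R) : \bar R := (phi p.2 * g (b + c * p.1 + d * p.2))%:E.
have mh' : measurable_fun setT h'.
  apply/measurable_EFinP; apply: measurable_funM.
    by apply: measurableT_comp => //; exact: measurable_snd.
  apply: measurableT_comp => //.
  apply: measurable_funD; last first.
    by apply: measurable_funM => //; exact: measurable_snd.
  apply: measurable_funD => //; apply: measurable_funM => //; exact: measurable_fst.
apply: measurableT_comp; first exact: fine_measurable.
apply: (@measurable_fun_fubini_tonelli_F _ _ _ _ _ leb h') => // p.
by rewrite lee_fin mulr_ge0 ?normal_pdf_ge0.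
Qed.

End Tame.

Section HasE.
Context {R : realType}.

(* [F] has expectation [e] under the standard normal law on [R^n], integrated
   one coordinate at a time in the order used by [iint]. *)
Fixpoint hasE (n : nat) : ('rV[R]_n -> R) -> R -> Prop :=
  match n return ('rV[R]_n -> R) -> R -> Prop with
  | 0 => fun F e => F 0 = e
  | k.+1 => fun F e => exists2 G : R -> R,
      forall x, hasE (fun v : 'rV[R]_k => F (vcons x v)) (G x) & hasE1 G e
  end.

Lemma eq_hasE n (F G : 'rV[R]_n -> R) e : F =1 G -> hasE F e -> hasE G e.
Proof. by move=> /funext ->. Qed.

Lemma hasE_cst n c : @hasE n (fun=> c) c.
Proof. by elim: n => //= n IH; exists (fun=> c) => //; exact: hasE1_cst. Qed.

Lemma hasED n (F G : 'rV[R]_n -> R) e e' : hasE F e -> hasE G e' ->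
  hasE (fun z => F z + G z) (e + e').
Proof.
elim: n F G e e' => [|n IH] F G e e' /=; first by move=> -> ->.
move=> [f hf hf1] [g hg hg1]; exists (fun x => f x + g x); last exact: hasE1D.
by move=> x; apply: IH.
Qed.

Lemma hasEZ n k (F : 'rV[R]_n -> R) e : hasE F e -> hasE (fun z => k * F z) (k * e).
Proof.
elim: n F e => [|n IH] F e /=; first by move=> ->.
move=> [f hf hf1]; exists (fun x => k * f x); last exact: hasE1Z.
by move=> x; apply: IH.
Qed.

Lemma hasE_sum n (I : Type) (r : seq I) (F : I -> 'rV[R]_n -> R) (e : I -> R) :
  (forall j, hasE (F j) (e j)) ->
  hasE (fun z => \sum_(j <- r) F j z) (\sum_(j <- r) e j).
Proof.
move=> h; elim: r => [|j r IH].
  by rewrite big_nil; apply: eq_hasE (hasE_cst _ _) => z; rewrite big_nil.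
by rewrite big_cons; apply: eq_hasE (hasED (h j) IH) => z; rewrite big_cons.
Qed.

Lemma vcons0 n x (v : 'rV[R]_n) : vcons x v 0 ord0 = x.
Proof. by rewrite mxE unlift_none. Qed.

Lemma vconsS n x (v : 'rV[R]_n) j : vcons x v 0 (lift ord0 j) = v 0 j.
Proof. by rewrite mxE liftK. Qed.

(** A linear form in standard normal coordinates is normal, its variance being the sum of the
    squared coefficients. Peeling off the first coordinate leaves a one-dimensional expectation,
    which [gauss_conv] merges with it. *)
Lemma hasE_affine n g b (c : 'I_n -> R) : tame g ->
  hasE (fun z : 'rV[R]_n => g (b + \sum_j z 0 j * c j))
       (E1 (fun x => g (b + Num.sqrt (\sum_j c j ^+ 2) * x))).
Proof.
move=> tg; elim: n b c => [|n IH] b c /=.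
  rewrite !big_ord0 sqrtr0 addr0; symmetry; apply: hasE1_E1.
  by apply: eq_hasE1 (hasE1_cst _) => x; rewrite mul0r addr0.
pose d := Num.sqrt (\sum_j c (lift ord0 j) ^+ 2).
exists (fun x => E1 (fun w => g (b + c ord0 * x + d * w))).
  move=> x; apply: eq_hasE (IH (b + c ord0 * x) (fun j => c (lift ord0 j))) => z.
  rewrite big_ord_recl vcons0 addrA [x * _]mulrC.
  by under [in RHS]eq_bigr do rewrite vconsS.
rewrite big_ord_recl; have := @gauss_conv _ g b (c ord0) d tg (sqrtr_ge0 _).
by rewrite sqr_sqrtr// sumr_ge0// => j _; rewrite sqr_ge0.
Qed.

Lemma hasE_sqr n b (c : 'I_n -> R) :
  hasE (fun z : 'rV[R]_n => (b + \sum_j z 0 j * c j) ^+ 2)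
       (b ^+ 2 + \sum_j c j ^+ 2).
Proof.
have := @hasE_affine n _ b c (@tame_sqr R).
by rewrite E1_sqr sqr_sqrtr// sumr_ge0// => j _; rewrite sqr_ge0.
Qed.

End HasE.

(** * Cholesky factors and Gaussian integrals *)

Section Cholesky.
Context {R : realType}.

(** With [L] lower triangular, each coordinate of [a + z *m L^T] depends only on the coordinates of
    [z] up to its own index, which fits the order of integration in [iint]. *)
Definition lower_pos n (L : 'M[R]_n) := is_trig_mx L /\ forall j, 0 < L j j.

Lemma lower_pos_det n (L : 'M[R]_n) : lower_pos L -> 0 < \det L.
Proof. by move=> [tL pL]; rewrite det_trig// prodr_gt0. Qed.

Lemma lower_pos_unit n (L : 'M[R]_n) : lower_pos L -> L \in unitmx.
Proof. by move=> /lower_pos_det d0; rewrite unitmxE unitfE gt_eqF. Qed.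

Lemma lower_pos_block k (L : 'M[R]_(1 + k)) : lower_pos L ->
  exists (l : R) (c : 'cV[R]_k) (L' : 'M[R]_k),
    [/\ 0 < l, lower_pos L' & L = block_mx l%:M 0 c L'].
Proof.
move=> [tL pL]; exists (L 0 0), (dlsubmx L), (drsubmx L); split => //.
- split; last by move=> j; rewrite !mxE.
  apply/is_trig_mxP => i j ij; rewrite !mxE.
  by move/is_trig_mxP : tL; apply; rewrite /= ltn_add2l.
- rewrite -[LHS]submxK; congr block_mx.
    rewrite [LHS]mx11_scalar; congr (scalar_mx _); rewrite !mxE.
    by congr (L _ _); apply/val_inj.
  apply/matrixP => i j; rewrite !mxE.
  move/is_trig_mxP : tL; apply.
  by rewrite /= ord1.
Qed.

Lemma block_lower_pos k (l : R) (c : 'cV[R]_k) (L' : 'M[R]_k) :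
  0 < l -> lower_pos L' -> lower_pos (block_mx l%:M 0 c L' : 'M[R]_(1 + k)).
Proof.
move=> l0 [tL pL]; split.
  by rewrite is_trig_block_mx// eqxx tL andbT /= mx11_is_trig.
move=> j; case: (split_ordP j) => i ->.
  by rewrite block_mxEul ord1 mxE eqxx.
by rewrite block_mxEdr.
Qed.

(** Induction on the size: the Schur complement of the first diagonal entry is again positive
    definite. *)
Lemma cholesky n (B : 'M[R]_n) : spd B ->
  exists2 L : 'M[R]_n, lower_pos L & B = L *m L^T.
Proof.
elim: n B => [|k IH] B.
  move=> _; exists 0; first by split; [exact: mx0_is_trig|case].
  by rewrite [LHS]flatmx0 [RHS]flatmx0.
rewrite -[k.+1]/(1 + k)%N in B *; move=> [sB pB].
pose r : 'rV[R]_k := ursubmx B; pose B' : 'M[R]_k := drsubmx B.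
pose b := B 0 0.
have BE : B = block_mx b%:M r r^T B'.
  rewrite -[LHS]submxK; congr block_mx.
    by rewrite [LHS]mx11_scalar; congr (scalar_mx _); rewrite !mxE; congr (B _ _); apply/val_inj.
  by rewrite /r -[in LHS]sB trmx_ursub.
have b0 : 0 < b.
  have := pB (row_mx 1 0).
  rewrite {1}BE mul_row_block tr_row_mx mul_row_col !mul0mx !addr0 trmx0 mulmx0 addr0.
  rewrite mul1mx trmx1 mulmx1 mxE eqxx mulr1n; apply.
  apply/eqP => /(congr1 (fun A : 'rV[R]_(1 + k) => lsubmx A 0 0)).
  by rewrite row_mxKl !mxE eqxx => /eqP; rewrite oner_eq0.
have [L' pL' L'E] : exists2 L' : 'M[R]_k, lower_pos L' & B' - b^-1 *: (r^T *m r) = L' *m L'^T.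
  apply: IH; split.
    rewrite linearB linearZ /= trmx_mul trmxK; congr (_ - _).
    by rewrite /B' -[in RHS]sB trmx_drsub.
  move=> v v0.
  (* The first coordinate minimizes the form of [B] over all extensions of [v]; the minimum is the
     form of the Schur complement at [v]. *)
  pose w : 'rV[R]_(1 + k) := row_mx (- b^-1 *: (v *m r^T)) v.
  have := pB w; rewrite {1}BE mul_row_block tr_row_mx mul_row_col.
  set X := (X in X 0 0); set Y := (Y in _ -> 0 < Y 0 0).
  have -> : X = Y.
    rewrite /X /Y mulmxBr mulmxBl -!scalemxAl -!scalemxAr -!scalemxAl.
    rewrite mul_mx_scalar scalerA mulNr mulVr ?unitfE ?gt_eqF// scaleN1r.
    rewrite addNr mul0mx add0r mulmxDl -scalemxAl mulmxA addrC scaleNr.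
    by [].
  apply; apply: contra_neq v0 => /(congr1 (fun A : 'rV[R]_(1 + k) => rsubmx A)).
  by rewrite row_mxKr linear0.
pose l := Num.sqrt b.
have l0 : 0 < l by rewrite sqrtr_gt0.
exists (block_mx l%:M 0 (l^-1 *: r^T) L'); first exact: block_lower_pos.
rewrite BE tr_block_mx mulmx_block !trmx0 !mul0mx !mulmx0 !addr0 tr_scalar_mx.
rewrite -scalar_mxM -expr2 sqr_sqrtr ?ltW// linearZ /= trmxK.
congr block_mx.
- by rewrite mul_scalar_mx scalerA mulrV ?scale1r// unitfE gt_eqF.
- by rewrite mul_mx_scalar scalerA mulrV ?scale1r// unitfE gt_eqF.
- rewrite -L'E -scalemxAl -scalemxAr scalerA -invfM -expr2 sqr_sqrtr ?ltW//.
  by rewrite addrC subrK.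
Qed.

Lemma mulmx_tr_spd n (L : 'M[R]_n) : L \in unitmx -> spd (L *m L^T).
Proof.
move=> uL; split; first by rewrite trmx_mul trmxK.
move=> v v0.
have -> : v *m (L *m L^T) *m v^T = (v *m L) *m (v *m L)^T.
  by rewrite trmx_mul !mulmxA.
rewrite mxE; under eq_bigr do rewrite [(v *m L)^T _ _]mxE -expr2.
rewrite lt_neqAle sumr_ge0 ?andbT; last by move=> j _; exact: sqr_ge0.
apply: contra_neq v0 => /esym /eqP.
rewrite psumr_eq0; last by move=> j _; exact: sqr_ge0.
move=> /allP h.
have /(congr1 (mulmx^~ (invmx L))) : v *m L = 0.
  apply/rowP => j; rewrite [RHS]mxE; apply/eqP.
  by rewrite -sqrf_eq0; apply: (h j); rewrite mem_index_enum.
by rewrite mulmxK// mul0mx.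
Qed.

Lemma spd_unit n (B : 'M[R]_n) : spd B -> B \in unitmx.
Proof.
by move=> /cholesky [L /lower_pos_unit uL ->]; rewrite unitmx_mul unitmx_tr uL.
Qed.

Lemma spd_det n (B : 'M[R]_n) : spd B -> 0 < \det B.
Proof.
move=> /cholesky [L /lower_pos_det uL ->].
by rewrite det_mulmx det_tr mulr_gt0.
Qed.

End Cholesky.

Section GaussianIntegral.
Context {R : realType}.
Local Notation leb := (@lebesgue_measure R).
Local Notation phi := (@normal_pdf R 0 1).

Definition dot n (u v : 'rV[R]_n) : R := (u *m v^T) 0 0.

Lemma dotE n (u v : 'rV[R]_n) : dot u v = \sum_j u 0 j * v 0 j.
Proof. by rewrite /dot mxE; apply: eq_bigr => j _; rewrite mxE. Qed.

Lemma quad_whiten n (L : 'M[R]_n) (z : 'rV[R]_n) : L \in unitmx ->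
  ((z *m L^T) *m invmx (L *m L^T) *m (z *m L^T)^T) 0 0 = dot z z.
Proof.
move=> uL.
have uB : L *m L^T \in unitmx by rewrite unitmx_mul unitmx_tr uL.
have E : L^T *m invmx (L *m L^T) *m L = 1%:M.
  by apply: mulmx1C; rewrite mulmxA mulmxV.
by rewrite /dot trmx_mul trmxK !mulmxA -(mulmxA z) -(mulmxA z) E mulmx1.
Qed.

Lemma mvn_whiten n (a : 'rV[R]_n) (L : 'M[R]_n) (z : 'rV[R]_n) : lower_pos L ->
  mvn_pdf a (L *m L^T) (a + z *m L^T) =
  ((Num.sqrt (pi *+ 2)) ^+ n * \det L)^-1 * expR (- dot z z / 2).
Proof.
move=> pL; have uL := lower_pos_unit pL; have d0 := lower_pos_det pL.
have p0 : (0 : R) <= pi *+ 2 by rewrite mulrn_wge0// pi_ge0.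
rewrite /mvn_pdf [a + _]addrC addrK quad_whiten// det_mulmx det_tr -expr2.
rewrite sqrtrM ?exprn_ge0// sqrtr_sqr gtr0_norm//; congr ((_ * _)^-1 * _).
by rewrite -[in LHS](sqr_sqrtr p0) -exprM mulnC exprM sqrtr_sqr ger0_norm// exprn_ge0.
Qed.

(** Divergence integrands change sign, so [integral_affine] is applied to the positive and negative
    parts separately. *)
Lemma integral_density_affine (p : R -> R) a l : 0 < l ->
  leb.-integrable setT (EFin \o p) ->
  (\int[leb]_x (l^-1 * p ((x - a) / l))%:E = \int[leb]_x (p x)%:E)%E.
Proof.
move=> l0 ip.
have mp : measurable_fun setT p by apply/measurable_EFinP; exact: (measurable_int leb).
have ln : l != 0 by rewrite gt_eqF.
pose f x := (l^-1 * p ((x - a) / l))%:E.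
have mf : measurable_fun setT f.
  apply/measurable_EFinP; apply: measurable_funM => //.
  apply: measurableT_comp => //; apply: measurable_funM => //; exact: measurable_funB.
have fE x : f (a + l * x) = (l^-1 * p x)%:E.
  by rewrite /f; congr (_ * p _)%:E; field.
rewrite -[LHS]/(\int[leb]_x f x)%E integralE [RHS]integralE; congr (_ - _)%E.
- rewrite (@integral_affine _ _ a l)//; last exact: measurable_funepos.
  rewrite -ge0_integralZl//; last exact: ltW.
    by apply: eq_integral => x _; rewrite !funeposE fE -EFin_max -EFin_max -EFinM
      maxr_pMr ?ltW// mulVKf// mulr0.
  apply: measurableT_comp; [exact: measurable_funepos|exact: measurable_affine].
- rewrite (@integral_affine _ _ a l)//; last exact: measurable_funeneg.
  rewrite -ge0_integralZl//; last exact: ltW.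
    by apply: eq_integral => x _; rewrite !funenegE fE -!EFinN -EFin_max -EFin_max -EFinM
      maxr_pMr ?ltW// mulrN mulVKf// mulr0.
  apply: measurableT_comp; [exact: measurable_funeneg|exact: measurable_affine].
Qed.

Lemma vcons_row_mx k (x : R) (v : 'rV[R]_k) :
  vcons x v = row_mx x%:M v :> 'rV[R]_(1 + k).
Proof.
apply/rowP => j; case: (split_ordP j) => i ->.
  rewrite row_mxEl ord1 [RHS]mxE eqxx mulr1n -[RHS](vcons0 x v).
  by congr (vcons x v _ _); apply/val_inj.
rewrite row_mxEr -[RHS](vconsS x v).
by congr (vcons x v _ _); apply/val_inj.
Qed.

(** The substitution [m = a + z *m L^T], one coordinate at a time: fixing the first coordinate of
    [m] fixes [z0], and the others are again Gaussian, with factor [L'] and a mean shifted by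
    [z0 *: c^T]. *)
Lemma iint_gauss n (a : 'rV[R]_n) (L : 'M[R]_n) (F : 'rV[R]_n -> R) e :
  lower_pos L -> hasE (fun z => F (a + z *m L^T)) e ->
  iint (fun m => (mvn_pdf a (L *m L^T) m * F m)%:E) = e%:E.
Proof.
elim: n a L F e => [|k IH] a L F e pL.
  rewrite (thinmx0 a) => /= <-; congr EFin.
  have := mvn_whiten 0 0 pL; rewrite !mul0mx addr0 expr0 det_mx00 mulr1 invr1 mul1r.
  by rewrite dotE big_ord0 oppr0 mul0r expR0 => ->; rewrite mul1r.
move=> /= [G hG [iG intG]].
rewrite -[k.+1]/(1 + k)%N in a L F pL hG *.
have [l [c [L' [l0 pL' LE]]]] := lower_pos_block pL.
pose a0 := a 0 0; pose a' : 'rV[R]_k := rsubmx a.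
have aE : a = row_mx a0%:M a'.
  rewrite -[LHS]hsubmxK; congr row_mx.
  by rewrite [LHS]mx11_scalar; congr (scalar_mx _); rewrite !mxE; congr (a _ _); apply/val_inj.
have shift z0 z' : a + (vcons z0 z' : 'rV[R]_(1 + k)) *m L^T =
    vcons (a0 + l * z0) (a' + z0 *: c^T + z' *m L'^T).
  rewrite !vcons_row_mx LE tr_block_mx. rewrite mul_row_block trmx0 mulmx0 addr0 aE.
  rewrite add_row_mx tr_scalar_mx -scalar_mxM mul_scalar_mx addrA mulrC.
  by rewrite -raddfD.
rewrite -intG -(integral_density_affine a0 l0)//; apply: eq_integral => x _.
set z0 := (x - a0) / l.
have xE : a0 + l * z0 = x by rewrite /z0; field; rewrite gt_eqF.
pose a2 := a' + z0 *: c^T.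
have dens v : mvn_pdf a (L *m L^T) (vcons x v) =
    l^-1 * phi z0 * mvn_pdf a2 (L' *m L'^T) v.
  have uL' := lower_pos_unit pL'.
  pose z' := (v - a2) *m invmx L'^T.
  have vE : v = a2 + z' *m L'^T by rewrite mulmxKV ?unitmx_tr// addrC subrK.
  rewrite -{1}xE vE -shift !mvn_whiten//.
  have -> : dot (vcons z0 z') (vcons z0 z') = z0 ^+ 2 + dot z' z'.
    rewrite !dotE big_ord_recl !vcons0 -expr2; congr (_ + _).
    by apply: eq_bigr => j _; rewrite !vconsS.
  rewrite LE det_lblock det_scalar1 phiE (exprD _ 1 k) expr1 opprD mulrDl expRD !invfM.
  by ring.
transitivity (iint (fun v => (mvn_pdf a2 (L' *m L'^T) v *
    (l^-1 * phi z0 * F (vcons x v)))%:E)).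
  by congr iint; apply/funext => v; rewrite dens; congr EFin; ring.
apply: IH => //; rewrite mulrA; apply: hasEZ.
apply: eq_hasE (hG z0) => z.
by rewrite shift xE.
Qed.

End GaussianIntegral.

(** * Log-concavity of the probit function *)

Section Probit.
Context {R : realType}.
Local Notation leb := (@lebesgue_measure R).
Local Notation phi := (@normal_pdf R 0 1).
Local Notation Phi := (@std_normal_cdf R).

Let mphi (D : set R) : measurable_fun D phi.
Proof. by apply: measurable_funTS; exact: measurable_normal_pdf. Qed.

Lemma measurable_phi_shift (D : set R) h : measurable_fun D (fun u => phi (u + h)).
Proof.
apply: measurable_funTS; apply: measurableT_comp; first exact: mphi.
exact: measurable_funD.
Qed.

Lemma cdfE x : (\int[leb]_(u in `]-oo, x]) (phi u)%:E = (Phi x)%:E)%E.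
Proof.
rewrite /std_normal_cdf fineK//.
apply: integrable_fin_num => //; apply: (integrableS measurableT) => //.
exact: integrable_normal_pdf.
Qed.

Lemma cdf_shift x h : (\int[leb]_(u in `]-oo, x]) (phi (u + h))%:E = (Phi (x + h))%:E)%E.
Proof.
rewrite -cdfE [RHS]integral_mkcond [LHS]integral_mkcond.
rewrite (@integral_affine _ (_ \_ `]-oo, x + h]) h 1)//; first last.
- by move=> u; rewrite patchE; case: ifP => // _; rewrite lee_fin normal_pdf_ge0.
- apply/(measurable_restrictT _ _).1 => //; exact/measurable_EFinP.
rewrite mul1e; apply: eq_integral => u _; rewrite mul1r !patchE !mem_setE !in_itv /=.
by rewrite [h + u]addrC lerD2r.
Qed.

Lemma cdf_itv x x' h : x <= x' ->
  (\int[leb]_(u in `]x, x']) (phi (u + h))%:E = (Phi (x' + h) - Phi (x + h))%:E)%E.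
Proof.
move=> xx.
have : (Phi (x' + h))%:E = ((Phi (x + h))%:E + \int[leb]_(u in `]x, x']) (phi (u + h))%:E)%E.
  rewrite -cdf_shift -[X in (X + _)%E]cdf_shift -ge0_integral_setU//=.
  - by rewrite -itv_bndbnd_setU.
  - by apply/measurable_EFinP; exact: measurable_phi_shift.
  - by move=> u _; rewrite lee_fin normal_pdf_ge0.
  - apply/disj_setPS => u [] /=; rewrite !in_itv /= => ux /andP[xu _].
    by move: xu; rewrite ltNge ux.
rewrite EFinB => ->; rewrite addeAC subee ?add0e//.
Qed.

Lemma cdf_itv0 x x' : x <= x' ->
  (\int[leb]_(u in `]x, x']) (phi u)%:E = (Phi x' - Phi x)%:E)%E.
Proof.
move=> xx; have := cdf_itv 0 xx; rewrite !addr0 => <-.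
by apply: eq_integral => u _; rewrite addr0.
Qed.

Lemma cdf_nd : {homo Phi : x y / x <= y}.
Proof.
move=> x y xy; rewrite -subr_ge0 -lee_fin -cdf_itv0//.
by apply: integral_ge0 => u _; rewrite lee_fin normal_pdf_ge0.
Qed.

Lemma cdf_ge0 x : 0 <= Phi x.
Proof.
by rewrite -lee_fin -cdfE; apply: integral_ge0 => u _; rewrite lee_fin normal_pdf_ge0.
Qed.

Lemma cdf_le1 x : Phi x <= 1.
Proof.
rewrite -lee_fin -cdfE -(@integral_normal_pdf R 0 1).
apply: ge0_subset_integral => //.
  by apply/measurable_EFinP; exact: mphi.
by move=> u _; rewrite lee_fin normal_pdf_ge0.
Qed.

Let k : R := (Num.sqrt (pi *+ 2))^-1.

Let k0 : 0 < k.
Proof. by rewrite invr_gt0 sqrtr_gt0 pmulrn_lgt0 ?pi_gt0. Qed.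

(** [Phi x] is at least the mass of []x - 1, x]], where [u ^+ 2 <= 2 + 2 * x ^+ 2]. This crude tail
    bound keeps the growth of [- ln Phi] at most quadratic. *)
Lemma cdf_lb x : k * expR (- (1 + x ^+ 2)) <= Phi x.
Proof.
apply: (@le_trans _ _ (Phi x - Phi (x - 1))); last by rewrite gerBl cdf_ge0.
rewrite -lee_fin -cdf_itv0; last by rewrite gerBl.
have -> : (k * expR (- (1 + x ^+ 2)))%:E =
    (\int[leb]_(u in `](x - 1)%R, x]) (cst (k * expR (- (1 + x ^+ 2)))%:E) u)%E.
  rewrite integral_cst//= lebesgue_measure_itv /= lte_fin ifT; last by rewrite gtrBl.
  by rewrite -EFinB -EFinM; congr EFin; ring.
apply: ge0_le_integral => //.
- by move=> u _; rewrite lee_fin mulr_ge0 ?expR_ge0 ?ltW.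
- by apply/measurable_EFinP; exact: mphi.
move=> u /=; rewrite in_itv /= => /andP[u1 u2].
rewrite lee_fin phiE -/k; apply: ler_wpM2l; first exact: ltW.
rewrite ler_expR.
have d0 : 0 <= x - u by lra.
have d1 : 0 <= 1 - (x - u) by lra.
by have := mulr_ge0 d0 d1; have := sqr_ge0 (x + (x - u)); lra.
Qed.

Lemma cdf_gt0 x : 0 < Phi x.
Proof. by apply: lt_le_trans (cdf_lb x); rewrite mulr_gt0 ?expR_gt0. Qed.

Lemma phi_shift u h : phi (u + h) = phi u * expR (- (u * h) - h ^+ 2 / 2).
Proof. by rewrite !phiE -mulrA -expRD; congr (_ * expR _); field. Qed.

(* [Phi (x + h) / Phi x] is the average of the decreasing function
   [u |-> exp (- u h - h^2 / 2)] over [u <= x], hence is nonincreasing in [x]. *)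
Lemma cdf_ratio x x' h : x <= x' -> 0 <= h ->
  Phi (x' + h) * Phi x <= Phi (x + h) * Phi x'.
Proof.
(* [w] is the value of the decreasing weight at [u = x]: the weight is at least [w] to the left of
   [x] ([A]) and at most [w] on []x, x']] ([B]). *)
move=> xx h0; pose w := expR (- (x * h) - h ^+ 2 / 2).
have w0 : 0 <= w by exact: expR_ge0.
have A : w * Phi x <= Phi (x + h).
  rewrite -lee_fin -cdf_shift.
  have -> : (w * Phi x)%:E = (\int[leb]_(u in `]-oo, x]) (w%:E * (phi u)%:E))%E.
    rewrite ge0_integralZl ?cdfE//.
      by apply/measurable_EFinP; exact: mphi.
    by move=> u _; rewrite lee_fin normal_pdf_ge0.
  apply: ge0_le_integral => //.
  - by move=> u _; rewrite -EFinM lee_fin mulr_ge0 ?normal_pdf_ge0.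
  - by apply: measurable_funeM; apply/measurable_EFinP; exact: mphi.
  - by apply/measurable_EFinP; exact: measurable_phi_shift.
  move=> u /=; rewrite in_itv /= => ux.
  rewrite -EFinM lee_fin phi_shift mulrC ler_wpM2l ?normal_pdf_ge0// ler_expR.
  by have := ler_wpM2r h0 ux; lra.
have B : Phi (x' + h) - Phi (x + h) <= w * (Phi x' - Phi x).
  rewrite -lee_fin -cdf_itv//.
  have -> : (w * (Phi x' - Phi x))%:E =
      (\int[leb]_(u in `]x, x']) (w%:E * (phi u)%:E))%E.
    rewrite ge0_integralZl ?cdf_itv0//.
      by apply/measurable_EFinP; exact: mphi.
    by move=> u _; rewrite lee_fin normal_pdf_ge0.
  apply: ge0_le_integral => //.
  - by move=> u _; rewrite lee_fin normal_pdf_ge0.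
  - by apply/measurable_EFinP; exact: measurable_phi_shift.
  - by apply: measurable_funeM; apply/measurable_EFinP; exact: mphi.
  move=> u /=; rewrite in_itv /= => /andP[xu _].
  rewrite -EFinM lee_fin phi_shift mulrC ler_wpM2r ?normal_pdf_ge0// ler_expR.
  by have := ler_wpM2r h0 (ltW xu); lra.
have h1 := ler_wpM2r (cdf_ge0 x) B.
have d0 : 0 <= Phi x' - Phi x by rewrite subr_ge0 cdf_nd.
have h2 := ler_wpM2r d0 A.
by lra.
Qed.

(** In [cdf_ratio], take [x] and the midpoint as base points and half the gap as shift: both sides
    become a product of end values and the square of the middle value. *)
Lemma ln_cdf_midconcave x x' :
  ln (Phi x) + ln (Phi x') <= 2 * ln (Phi ((x + x') / 2)).
Proof.
wlog xx : x x' / x <= x' => [H|].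
  by have [|/ltW] := leP x x'; [|rewrite addrC [x + _]addrC]; exact: H.
have := @cdf_ratio x ((x + x') / 2) ((x' - x) / 2).
have -> : (x + x') / 2 + (x' - x) / 2 = x' by field.
have -> : x + (x' - x) / 2 = (x + x') / 2 by field.
move=> H; have {}H : Phi x' * Phi x <= Phi ((x + x') / 2) * Phi ((x + x') / 2) by apply: H; lra.
rewrite -lnM ?posrE ?cdf_gt0// mulr_natl mulr2n -lnM ?posrE ?cdf_gt0//.
by rewrite ler_ln ?posrE ?mulr_gt0 ?cdf_gt0// mulrC.
Qed.

Lemma measurable_cdf : measurable_fun setT Phi.
Proof. by apply: nondecreasing_measurable => // x y; exact: cdf_nd. Qed.

Lemma tame_cdf y : tame (fun x => Phi (y * x)).
Proof.
split; [|by move=> x; exact: cdf_ge0|].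
  by apply: measurableT_comp; [exact: measurable_cdf|exact: measurable_funM].
by exists 1 => x; rewrite mul1r (le_trans (cdf_le1 _))// lerDl sqr_ge0.
Qed.

Lemma tame_ln_cdf y : tame (fun x => - ln (Phi (y * x))).
Proof.
split.
- apply: measurable_funN; apply: measurableT_comp; first exact: measurable_ln.
  by apply: measurableT_comp; [exact: measurable_cdf|exact: measurable_funM].
- by move=> x; rewrite oppr_ge0 ln_le0// cdf_le1.
(* By [cdf_lb], [- ln (Phi (y * x))] is at most [- ln k + 1 + y ^+ 2 * x ^+ 2]. *)
exists (`|ln k| + 1 + y ^+ 2) => x.
have := cdf_lb (y * x); rewrite -ler_ln ?posrE ?mulr_gt0 ?expR_gt0 ?cdf_gt0//.
rewrite lnM ?posrE ?expR_gt0// expRK.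
have h1 := lerNnormlW (lexx `|ln k|).
have h2 : 0 <= `|ln k| * x ^+ 2 by rewrite mulr_ge0 ?sqr_ge0.
have h3 := sqr_ge0 x; have h4 := sqr_ge0 y.
by rewrite exprMn; lra.
Qed.

End Probit.

(** * Divergence formulas *)

Section DivergenceFormulas.
Context {R : realType}.
Local Notation leb := (@lebesgue_measure R).
Local Notation phi := (@normal_pdf R 0 1).

Definition frob n (T : 'M[R]_n) : R := \sum_j \sum_k T j k ^+ 2.

Lemma frob1 n : frob (1%:M : 'M[R]_n) = n%:R.
Proof.
rewrite /frob; under eq_bigr => j _.
  rewrite (bigD1 j)//= mxE eqxx expr1n big1 ?addr0; last first.
    by move=> k kj; rewrite mxE eq_sym (negbTE kj) expr0n.
  over.
by rewrite sumr_const card_ord.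
Qed.

Lemma mulmx_trE n (z : 'rV[R]_n) (T : 'M[R]_n) j :
  (z *m T^T) 0 j = \sum_k z 0 k * T j k.
Proof. by rewrite mxE; apply: eq_bigr => k _; rewrite mxE. Qed.

Lemma hasE_dot n (b : 'rV[R]_n) (T : 'M[R]_n) :
  hasE (fun z => dot (b + z *m T^T) (b + z *m T^T)) (dot b b + frob T).
Proof.
rewrite dotE /frob -big_split /=.
apply: eq_hasE (hasE_sum _ (fun j => hasE_sqr (b 0 j) (T j))) => z.
by rewrite dotE; apply: eq_bigr => j _; rewrite mxE mulmx_trE -expr2.
Qed.

Lemma normalize_mvn n (a : 'rV[R]_n) (B : 'M[R]_n) : spd B ->
  normalize (mvn_pdf a B) = mvn_pdf a B.
Proof.
move=> /cholesky [L pL ->]; apply/funext => m; rewrite /normalize.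
have := @iint_gauss _ _ a L (fun=> 1) 1 pL (hasE_cst n 1).
under eq_fun do rewrite mulr1.
by move=> ->; rewrite /= divr1.
Qed.

Definition row_norm n (L : 'M[R]_n) i := Num.sqrt (\sum_k L i k ^+ 2).

Lemma hasE_coord n (a : 'rV[R]_n) (L : 'M[R]_n) i g : tame g ->
  hasE (fun z => g ((a + z *m L^T) 0 i))
    (E1 (fun x => g (a 0 i + row_norm L i * x))).
Proof.
move=> tg; apply: eq_hasE (hasE_affine (a 0 i) (L i) tg) => z.
by rewrite mxE mulmx_trE.
Qed.

Lemma ln_ratio (p x q y G Z : R) : 0 < p -> 0 < q -> 0 < G -> 0 < Z ->
  ln (p * expR x / (q * expR y * G / Z)) = ln p + x - ln q - y - ln G + ln Z.
Proof.
move=> p0 q0 G0 Z0.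
have x0 := expR_gt0 x; have y0 := expR_gt0 y.
have n0 := mulr_gt0 p0 x0; have q1 := mulr_gt0 q0 y0.
have d0 := mulr_gt0 q1 G0; have r0 := divr_gt0 d0 Z0.
rewrite ln_div ?posrE// [ln (_ / Z)]ln_div ?posrE// !lnM ?posrE// !expRK.
by ring.
Qed.

Section Posterior.
Variable g : R -> R.
Hypotheses (g_gt0 : forall x, 0 < g x) (tg : tame g)
  (tlg : tame (fun x => - ln (g x))).

Lemma iint_mvn_coord n (mu : 'rV[R]_n) (M : 'M[R]_n) i : lower_pos M ->
  iint (fun m => (mvn_pdf mu (M *m M^T) m * g (m 0 i))%:E) =
  (E1 (fun x => g (mu 0 i + row_norm M i * x)))%:E.
Proof. by move=> pM; apply: iint_gauss => //; exact: hasE_coord. Qed.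

Lemma E1_affine_gt0 b s : 0 < E1 (fun x => g (b + s * x)).
Proof. by apply: hasE1_gt0 (tame_affine b s tg) _ => x. Qed.

(** With [m = a + z *m L^T], the log-ratio is a constant minus [dot z z / 2], plus half the squared
    norm of [m] whitened by the prior, minus [ln g]. Tameness of [g] makes the normalizing constant
    finite, that of [- ln g] the last expectation. *)
Lemma KL_mvn n (mu a : 'rV[R]_n) (M L : 'M[R]_n) i : lower_pos M -> lower_pos L ->
  KL (normalize (mvn_pdf a (L *m L^T)))
     (normalize (fun m => mvn_pdf mu (M *m M^T) m * g (m 0 i))) =
  (ln (\det M) - n%:R / 2 + ln (E1 (fun x => g (mu 0 i + row_norm M i * x)))
   - ln (\det L)
   + (dot ((a - mu) *m (invmx M)^T) ((a - mu) *m (invmx M)^T)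
      + frob (invmx M *m L)) / 2
   + E1 (fun x => - ln (g (a 0 i + row_norm L i * x))))%:E.
Proof.
move=> pM pL; have uM := lower_pos_unit pM; have uL := lower_pos_unit pL.
rewrite normalize_mvn; last exact: mulmx_tr_spd.
rewrite /KL /normalize iint_mvn_coord//=.
set Z := E1 (fun x => g _); have Z0 : 0 < Z := E1_affine_gt0 _ _.
set be := (a - mu) *m _; set T := invmx M *m L.
set K := Num.sqrt (pi *+ 2 : R).
have K0 : 0 < K by rewrite sqrtr_gt0 mulrn_wgt0// pi_gt0.
have dM := lower_pos_det pM; have dL := lower_pos_det pL.
apply: iint_gauss => //.
pose c := ln (\det M) + ln Z - ln (\det L).
have H := hasED (hasED (hasE_cst n c) (hasEZ (- 2^-1) (hasE_dot 0 1%:M)))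
  (hasED (hasEZ 2^-1 (hasE_dot be T)) (hasE_coord a L i tlg)).
set e := (X in hasE _ X); set e' := (X in hasE _ X) in H.
have -> : e = e'.
  rewrite /e /e' frob1 [dot 0 0]dotE big1; last by move=> j _; rewrite mxE mul0r.
  by rewrite /c; field.
apply: eq_hasE H => z.
rewrite trmx1 mulmx1 add0r.
(* The same point in the whitened coordinates of the prior, namely [be + z *m T^T]. *)
have mE : a + z *m L^T = mu + (be + z *m T^T) *m M^T.
  have e1 : (invmx M)^T *m M^T = 1%:M by rewrite -trmx_mul mulmxV// trmx1.
  have e2 : T^T *m M^T = L^T by rewrite -trmx_mul /T mulmxA mulmxV// mul1mx.
  by rewrite mulmxDl /be -!mulmxA e1 e2 mulmx1 addrA [mu + _]addrC subrK.
rewrite (mvn_whiten a z pL) {2}mE (mvn_whiten mu _ pM) -/K.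
set w := be + _; set G := g _; have G0 : 0 < G := g_gt0 _.
rewrite /c.
have Kn : 0 < K ^+ n by rewrite exprn_gt0.
rewrite ln_ratio ?invr_gt0 ?mulr_gt0//.
rewrite !lnV ?posrE ?mulr_gt0// !lnM ?posrE//.
by field.
Qed.

End Posterior.

Lemma integral_normal_tame (m s : R) f : 0 < s -> tame f ->
  (\int[leb]_x (normal_pdf m s x * f x)%:E = (E1 (fun x => f (m + s * x)))%:E)%E.
Proof.
by move=> s0 tf; have [mf f0 _] := tf; rewrite integral_phi_gauss//;
  case: (tame_affine m s tf).
Qed.

Lemma normalize1_scale (c e : R) (f : R -> R) : 0 < c -> 0 < e ->
  measurable_fun setT f -> (forall x, 0 <= f x) ->
  (\int[leb]_x (f x)%:E = e%:E)%E ->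
  normalize1 (fun t => c * f t) = fun t => f t / e.
Proof.
move=> c0 e0 mf f0 fe; apply/funext => t; rewrite /normalize1.
under eq_integral do rewrite EFinM.
rewrite ge0_integralZl//; first last.
- exact: ltW.
- by move=> x _; rewrite lee_fin.
- exact/measurable_EFinP.
by rewrite fe /= ; field; rewrite !gt_eqF.
Qed.

(** Precisions add, and so do precision-weighted means. *)
Lemma normal_pdf_mul (m s a t al ta : R) : 0 < s -> 0 < t -> 0 < ta ->
  ta ^- 2 = s ^- 2 + t ^- 2 -> al * ta ^- 2 = m * s ^- 2 + a * t ^- 2 ->
  exists2 c, 0 < c & forall x,
    normal_pdf m s x * normal_pdf a t x = c * normal_pdf al ta x.
Proof.
move=> s0 t0 ta0 h1 h2.
pose k := phi 0; have k0 : 0 < k := phi_gt0 0.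
have phik z : phi z = k * expR (- z ^+ 2 / 2).
  by rewrite /k !phiE expr0n oppr0 mul0r expR0 mulr1.
(* The quotient of the normalizing factors times what completing the square leaves over. *)
exists (s^-1 * t^-1 * ta * k *
  expR ((al ^+ 2 * ta ^- 2 - m ^+ 2 * s ^- 2 - a ^+ 2 * t ^- 2) / 2)).
  by rewrite !mulr_gt0 ?expR_gt0 ?invr_gt0.
move=> x; rewrite (normal_pdfE_phi m x s0) (normal_pdfE_phi a x t0).
rewrite (normal_pdfE_phi al x ta0) !phik.
rewrite !exprMn !exprVn.
transitivity (s^-1 * t^-1 * k * k * (expR (- ((x - m) ^+ 2 / s ^+ 2) / 2)
   * expR (- ((x - a) ^+ 2 / t ^+ 2) / 2))); first by ring.
rewrite -expRD.
transitivity (s^-1 * t^-1 * k * k * (expR ((al ^+ 2 * ta ^- 2 - m ^+ 2 * s ^- 2 - a ^+ 2 * t ^- 2) / 2)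
   * expR (- ((x - al) ^+ 2 / ta ^+ 2) / 2))); last by field; rewrite !gt_eqF.
rewrite -expRD; congr (_ * expR _).
move: h1 h2; set p := s ^- 2; set q := t ^- 2; set r := ta ^- 2 => h1 h2.
(* Multiplied by [x] and [x ^+ 2], the two hypotheses make the comparison of exponents linear in the
   monomials. *)
have h3 := congr1 (fun z => x * z) h2.
have h4 := congr1 (fun z => x ^+ 2 * z) h1.
by rewrite /= in h3 h4; lra.
Qed.

Lemma KL1_normal (g : R -> R) (m s al ta Z : R) : (forall x, 0 < g x) ->
  tame (fun x => - ln (g x)) -> 0 < s -> 0 < ta -> 0 < Z ->
  KL1 (normal_pdf al ta) (fun t => normal_pdf m s t * g t / Z) =
  (ln s + ln Z - 2^-1 - ln ta + (((al - m) / s) ^+ 2 + (ta / s) ^+ 2) / 2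
   + E1 (fun x => - ln (g (al + ta * x))))%:E.
Proof.
move=> g0 tlg s0 ta0 Z0; rewrite /KL1.
pose c := ln s + ln Z - ln ta.
have H := hasE1D (hasE1D (hasE1_cst c) (hasE1Z (- 2^-1) hasE1_sqr))
  (hasE1D (hasE1Z 2^-1 (tame_affine ((al - m) / s) (ta / s) (@tame_sqr R)))
     (tame_affine al ta tlg)).
set e := (X in hasE1 _ X) in H.
transitivity e%:E; last by congr EFin; rewrite /e E1_sqr /c; field; rewrite gt_eqF.
case: H => iH <-; rewrite -(integral_density_affine al ta0 iH).
apply: eq_integral => t _; congr EFin.
rewrite {1}(normal_pdfE_phi al t ta0) -[LHS]mulrA /=; congr (_ * (_ * _)).
set z := (t - al) / ta.
have zE : al + ta * z = t by rewrite /z; field; rewrite gt_eqF.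
rewrite zE (normal_pdfE_phi al t ta0) (normal_pdfE_phi m t s0) -/z.
rewrite (_ : (t - m) / s = (al - m) / s + ta / s * z); last first.
  by rewrite -zE; field; rewrite gt_eqF.
pose k := phi 0; have k0 : 0 < k := phi_gt0 0.
have phik u : phi u = k * expR (- u ^+ 2 / 2).
  by rewrite /k !phiE expr0n oppr0 mul0r expR0 mulr1.
rewrite !phik /c; have := g0 t; set G := g t => G0.
rewrite ![_^-1 * (_ * expR _)]mulrA ln_ratio ?mulr_gt0 ?invr_gt0//.
rewrite !lnM ?posrE ?invr_gt0// !lnV ?posrE//.
by field; rewrite !gt_eqF.
Qed.

End DivergenceFormulas.

(** * Determinants, traces and quadratic forms of positive definite matrices *)

Section MatrixFacts.
Context {R : realType}.

(** The bordered matrix [A] has two block triangular factorizations; their determinants are the two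
    sides. *)
Lemma det_1D_rank1 n (c : 'cV[R]_n) (r : 'rV[R]_n) :
  \det (1%:M + c *m r) = 1 + (r *m c) 0 0.
Proof.
pose A : 'M[R]_(1 + n) := block_mx 1%:M (- r) c 1%:M.
have h1 : A = (block_mx 1%:M 0 c 1%:M : 'M[R]_(1 + n)) *m
    (block_mx 1%:M (- r) 0 (1%:M + c *m r) : 'M[R]_(1 + n)).
  rewrite mulmx_block !mul1mx !mul0mx !mulmx1 !addr0 mulmxN.
  by rewrite addrCA addNr addr0.
have h2 : A = (block_mx (1%:M + r *m c) (- r) 0 1%:M : 'M[R]_(1 + n)) *m
    (block_mx 1%:M 0 c 1%:M : 'M[R]_(1 + n)).
  rewrite mulmx_block !mul1mx !mul0mx !mulmx1 mulmx0 !add0r.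
  by rewrite mulNmx addrK.
have := congr1 determinant h1; rewrite h2 !det_mulmx !det_ublock !det_lblock.
rewrite !det1 !mulr1 !mul1r => <-.
by rewrite det_mx11 !mxE eqxx.
Qed.

Lemma invmx_uniq n (A X : 'M[R]_n) : A *m X = 1%:M -> invmx A = X.
Proof.
move=> h; have [uA _] := mulmx1_unit h.
by rewrite -[LHS]mulmx1 -h mulmxA mulVmx// mul1mx.
Qed.

Definition qf n (K : 'M[R]_n) (x : 'rV[R]_n) : R := (x *m K *m x^T) 0 0.

Lemma frob_tr n (T : 'M[R]_n) : frob T = \tr (T *m T^T).
Proof.
rewrite /frob /mxtrace; apply: eq_bigr => j _.
by rewrite mxE; apply: eq_bigr => k _; rewrite mxE expr2.
Qed.

Lemma dot_whiten n (M : 'M[R]_n) x : M \in unitmx ->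
  dot (x *m (invmx M)^T) (x *m (invmx M)^T) = qf (invmx (M *m M^T)) x.
Proof.
move=> uM; have e : x *m (invmx M)^T *m M^T = x.
  by rewrite -mulmxA -trmx_mul mulmxV// trmx1 mulmx1.
by rewrite -(quad_whiten _ uM) e.
Qed.

Lemma frob_whiten n (M L : 'M[R]_n) : M \in unitmx ->
  frob (invmx M *m L) = \tr (invmx (M *m M^T) *m (L *m L^T)).
Proof.
move=> uM; rewrite frob_tr trmx_mul.
have -> : invmx (M *m M^T) = (invmx M)^T *m invmx M.
  apply: invmx_uniq; rewrite mulmxA -[_ *m M^T *m _]mulmxA -trmx_mul mulVmx//.
  by rewrite trmx1 mulmx1 mulmxV.
by rewrite mulmxA mxtrace_mulC !mulmxA.
Qed.

Lemma row_norm_chol n (L : 'M[R]_n) i : row_norm L i = Num.sqrt ((L *m L^T) i i).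
Proof.
rewrite /row_norm; congr Num.sqrt; rewrite mxE; apply: eq_bigr => k _.
by rewrite mxE expr2.
Qed.

Lemma ln_det_chol n (L : 'M[R]_n) : lower_pos L ->
  ln (\det (L *m L^T)) = 2 * ln (\det L).
Proof.
move=> /lower_pos_det d0.
by rewrite det_mulmx det_tr lnM ?posrE// mulr_natl mulr2n.
Qed.

(** [KL_mvn] freed of the Cholesky factors; [c] is chosen before [a] and [B], so it cancels when two
    divergences are compared. *)
Lemma KL_mvn_trace n (g : R -> R) (mu : 'rV[R]_n) (Sigma : 'M[R]_n) i :
  (forall x, 0 < g x) -> tame g -> tame (fun x => - ln (g x)) -> spd Sigma ->
  exists c, forall a B, spd B ->
  KL (normalize (mvn_pdf a B))
     (normalize (fun m => mvn_pdf mu Sigma m * g (m 0 i))) =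
  (c + (- ln (\det B) + qf (invmx Sigma) (a - mu) + \tr (invmx Sigma *m B)) / 2
   + E1 (fun x => - ln (g (a 0 i + Num.sqrt (B i i) * x))))%:E.
Proof.
move=> g0 tg tlg /cholesky [M pM ->].
exists (ln (\det M) - n%:R / 2 + ln (E1 (fun x => g (mu 0 i + row_norm M i * x)))).
move=> a B /cholesky [L pL ->].
have uM := lower_pos_unit pM.
rewrite (KL_mvn g0 tg tlg mu a i pM pL) (dot_whiten _ uM) (frob_whiten _ uM).
rewrite -(row_norm_chol L) (ln_det_chol pL); congr EFin.
set p := qf _ _; set q := \tr _; set e := E1 _; set e' := E1 _.
by field.
Qed.

Lemma ln_lt_sub1 (x : R) : 0 < x -> x != 1 -> ln x < x - 1.
Proof.
move=> x0 x1; have l0 : ln x != 0 by rewrite ln_eq0.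
by have := expR_gt1Dx l0; rewrite lnK ?posrE//; lra.
Qed.

Lemma ln_le_sub1 (x : R) : 0 < x -> ln x <= x - 1.
Proof.
move=> x0; have [->|/(ln_lt_sub1 x0)/ltW//] := eqVneq x 1.
by rewrite ln1 subrr.
Qed.

(** In terms of the Cholesky factor [T], the trace is the sum of all squared entries and the
    log-determinant involves only the diagonal, so [ln x <= x - 1] on [T j j ^+ 2] is enough and
    eigenvalues are avoided. *)
Lemma ln_det_trace n (X : 'M[R]_n) : spd X ->
  ln (\det X) <= \tr X - n%:R /\ (ln (\det X) = \tr X - n%:R -> X = 1%:M).
Proof.
move=> /cholesky [T pT ->]; have [tT dT] := pT.
have dsum : ln (\det (T *m T^T)) = \sum_j ln (T j j ^+ 2).
  have [_ lnE] : 0 < \prod_j T j j /\ ln (\prod_j T j j) = \sum_j ln (T j j).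
    apply: (big_ind2 (fun p s => 0 < p /\ ln p = s)) => //; first by rewrite ln1.
    by move=> p s p' s' [p0 <-] [p0' <-]; rewrite mulr_gt0// lnM.
  rewrite ln_det_chol// det_trig// lnE.
  by rewrite mulr_sumr; apply: eq_bigr => j _; rewrite (lnXn _ (dT j)) mulr_natl.
(* The share of row [j] in the gap: it vanishes only if [T j j = 1] and the rest of the row is
   zero. *)
pose f j := \sum_k T j k ^+ 2 - 1 - ln (T j j ^+ 2).
have offd j k : j != k -> T j k ^+ 2 <= \sum_k T j k ^+ 2 - T j j ^+ 2.
  move=> jk; rewrite (bigD1 j)//= addrAC subrr add0r.
  rewrite (bigD1 k) 1?eq_sym//= lerDl sumr_ge0// => l _; exact: sqr_ge0.
have diag j : T j j ^+ 2 <= \sum_k T j k ^+ 2.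
  by rewrite (bigD1 j)//= lerDl sumr_ge0// => l _; exact: sqr_ge0.
have f0 j : 0 <= f j.
  have := ln_le_sub1 (exprn_gt0 2 (dT j)); have := diag j; rewrite /f; lra.
have fsum : \tr (T *m T^T) - n%:R - ln (\det (T *m T^T)) = \sum_j f j.
  rewrite -frob_tr dsum /f /frob !sumrB; congr (_ - _ - _).
  by rewrite sumr_const card_ord.
split; first by rewrite -subr_ge0 fsum sumr_ge0.
move=> /eqP; rewrite eq_sym -subr_eq0 fsum psumr_eq0// => /allP h.
have fz j : f j = 0 by apply/eqP/h; rewrite mem_index_enum.
have T1 j : T j j = 1.
  apply/eqP; rewrite -(@eqrXn2 _ 2)// ?ltW// expr1n.
  apply/negPn/negP => /(ln_lt_sub1 (exprn_gt0 2 (dT j))).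
  by have := diag j; have := fz j; rewrite /f; lra.
suff -> : T = 1%:M by rewrite trmx1 mulmx1.
apply/matrixP => j k; rewrite !mxE; have [<-|jk] := eqVneq j k; first by rewrite T1.
apply/eqP; rewrite -sqrf_eq0 eq_le sqr_ge0 andbT (le_trans (offd j k jk))//.
by have := fz j; rewrite /f T1 expr1n ln1; lra.
Qed.

End MatrixFacts.

(** * Rank-one tilts of the prior *)

Section Tilt.
Context {R : realType}.
Local Notation leb := (@lebesgue_measure R).
Variables (n : nat) (mu : 'rV[R]_n) (Sigma : 'M[R]_n) (i : 'I_n).
Hypothesis hS : spd Sigma.

Let K := invmx Sigma.
Let e : 'rV[R]_n := delta_mx 0 i.
Let r := row i Sigma.
Let s2 := Sigma i i.

Let uS : Sigma \in unitmx := spd_unit hS.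
Let rE : r = e *m Sigma. Proof. by rewrite /r rowE. Qed.
Let symS : Sigma^T = Sigma. Proof. by case: hS. Qed.
Let symK : K^T = K. Proof. by rewrite /K trmx_inv symS. Qed.
Let rK : r *m K = e. Proof. by rewrite rE mulmxK. Qed.
Let Kr : K *m r^T = e^T. Proof. by rewrite -rK trmx_mul symK. Qed.
Let er : e *m r^T = s2%:M.
Proof. by rewrite [LHS]mx11_scalar -rowE !mxE. Qed.
Let re : r *m e^T = s2%:M.
Proof. by rewrite -[LHS]trmxK trmx_mul trmxK er tr_scalar_mx. Qed.
Let Se : Sigma *m e^T = r^T. Proof. by rewrite rE trmx_mul symS. Qed.
Let xe (x : 'rV[R]_n) : x *m e^T = (x 0 i)%:M.
Proof.
rewrite [LHS]mx11_scalar; congr (scalar_mx _).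
by rewrite /e trmx_delta -colE mxE.
Qed.

Lemma spd_diag_gt0 : 0 < s2.
Proof.
case: hS => _ /(_ e); rewrite -rE re mxE eqxx mulr1n; apply.
apply/eqP => /rowP /(_ i); rewrite !mxE !eqxx /= => /eqP; by rewrite oner_eq0.
Qed.
Let s20 : 0 < s2 := spd_diag_gt0.
Let s2n : s2 != 0. Proof. by rewrite gt_eqF. Qed.

(** Under the centered prior, the subtracted term is the conditional mean given the [i]-th
    coordinate, and the remainder is independent of that coordinate. *)
Definition resid (x : 'rV[R]_n) := x - (x 0 i / s2) *: r.

Lemma resid_coord x : resid x 0 i = 0.
Proof. by rewrite !mxE -/s2 divfK// subrr. Qed.

Lemma resid_shift x b : resid (x - b *: r) = resid x.
Proof.
rewrite /resid !mxE -/s2 -addrA -opprD -scalerDl; congr (_ - _ *: _).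
by field.
Qed.

(** Pythagoras for the form [K]: since [r *m K = e], the row [r] is [K]-orthogonal to every vector
    with vanishing [i]-th coordinate. *)
Lemma qf_resid x : qf K x = x 0 i ^+ 2 / s2 + qf K (resid x).
Proof.
set d := resid x; set b := x 0 i / s2.
have xE : x = b *: r + d by rewrite /d /resid addrC subrK.
have d0 : d *m e^T = 0 by rewrite xe resid_coord raddf0.
have d0' : e *m d^T = 0 by rewrite -[LHS]trmxK trmx_mul trmxK d0 trmx0.
clearbody d.
rewrite /qf [in LHS]xE mulmxDl -scalemxAl rK linearD linearZ /=.
rewrite mulmxDr !mulmxDl -!scalemxAl -!scalemxAr -[d *m K *m r^T]mulmxA Kr er d0 d0'.
rewrite !scaler0 addr0 !mxE eqxx mulr1n add0r; congr (_ + _).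
by rewrite /b; field.
Qed.

(** Together with [tilt_cov], the normal law whose [i]-th marginal has mean [al] and variance [v]
    and whose conditional law given the [i]-th coordinate is that of the prior. *)
Definition tilt_mean al : 'rV[R]_n := mu + ((al - mu 0 i) / s2) *: r.
Definition tilt_cov v : 'M[R]_n := Sigma + ((v / s2 - 1) / s2) *: (r^T *m r).

Lemma tilt_mean_coord al : tilt_mean al 0 i = al.
Proof. by rewrite !mxE -/s2 divfK// addrC subrK. Qed.

Lemma tilt_cov_diag v : tilt_cov v i i = v.
Proof. by rewrite !mxE big_ord1 !mxE -/s2; field. Qed.

Lemma tilt_factor v : 0 < v ->
  exists2 N, tilt_cov v = N *m N^T & N \in unitmx /\ \det N ^+ 2 = v / s2 * \det Sigma.
Proof.
move=> v0; have [M pM SE] := cholesky hS.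
(* Chosen so that [1 + ga * s2] is the square root of [v / s2]: then [U] rescales the [i]-th
   coordinate to variance [v] and moves the others along the regression on it. *)
pose ga := (Num.sqrt (v / s2) - 1) / s2.
have vs0 : 0 < v / s2 by rewrite divr_gt0.
have q2 : Num.sqrt (v / s2) ^+ 2 = v / s2 by rewrite sqr_sqrtr ?ltW.
pose U := 1%:M + (ga *: r^T) *m e.
have dU : \det U = Num.sqrt (v / s2).
  rewrite /U det_1D_rank1 -scalemxAr er !mxE eqxx mulr1n /ga.
  by rewrite divfK// addrC subrK.
exists (U *m M); last first.
  rewrite unitmx_mul (lower_pos_unit pM) andbT unitmxE unitfE dU gt_eqF ?sqrtr_gt0//.
  by split=> //; rewrite det_mulmx dU exprMn q2 SE det_mulmx det_tr expr2.
have UT : U^T = 1%:M + ga *: (e^T *m r).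
  by rewrite /U linearD /= trmx1 -scalemxAl linearZ /= trmx_mul trmxK.
have US : U *m Sigma = Sigma + ga *: (r^T *m r).
  by rewrite /U mulmxDl mul1mx -!scalemxAl -mulmxA -rE.
have rr : r^T *m r *m (e^T *m r) = s2 *: (r^T *m r).
  by rewrite mulmxA -[r^T *m r *m e^T]mulmxA re mul_mx_scalar -scalemxAl.
rewrite trmx_mul mulmxA -[U *m M *m _]mulmxA -SE US UT.
rewrite mulmxDr mulmx1 mulmxDl -!scalemxAr -scalemxAl rr mulmxA Se.
rewrite /tilt_cov !scalerA -!addrA; congr (_ + _).
rewrite -!scalerDl; congr (_ *: _).
rewrite /ga; move: q2; set q := Num.sqrt _ => q2.
transitivity ((q ^+ 2 - 1) / s2); first by rewrite q2.
by field.
Qed.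

Lemma tilt_spd v : 0 < v -> spd (tilt_cov v).
Proof. by move=> /tilt_factor [N -> [uN _]]; exact: mulmx_tr_spd. Qed.

Lemma tilt_det v : 0 < v -> \det (tilt_cov v) = v / s2 * \det Sigma.
Proof.
by move=> /tilt_factor [N -> [_ <-]]; rewrite det_mulmx det_tr expr2.
Qed.

(** Sherman-Morrison: the rank-one change along [r] alters only entry [(i, i)] of the precision,
    exactly as a Gaussian factor in [m_i] does. *)
Lemma tilt_inv v : 0 < v ->
  invmx (tilt_cov v) = K + (v^-1 - s2^-1) *: (e^T *m e).
Proof.
move=> v0; apply: invmx_uniq.
rewrite /tilt_cov mulmxDl !mulmxDr mulmxV// -!scalemxAl -!scalemxAr.
rewrite mulmxA Se -[r^T *m r *m K]mulmxA rK.
rewrite [_ *m (e^T *m e)]mulmxA -[r^T *m r *m e^T]mulmxA re mul_mx_scalar.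
rewrite -[(s2 *: r^T) *m e]scalemxAl !scalerA -!addrA -!scalerDl.
set c := (X in X *: (r^T *m e)).
have -> : c = 0 by rewrite /c; field; rewrite s2n gt_eqF.
by rewrite scale0r addr0.
Qed.

Lemma tilt_trace v : \tr (K *m tilt_cov v) = n%:R + v / s2 - 1.
Proof.
rewrite /tilt_cov mulmxDr mulVmx// linearD /= mxtrace1 -scalemxAr linearZ /=.
rewrite mulmxA Kr mxtrace_mulC re mxtrace_scalar mulr1n -addrA; congr (_ + _).
by field.
Qed.

Lemma tilt_qf al : qf K (tilt_mean al - mu) = (al - mu 0 i) ^+ 2 / s2.
Proof.
rewrite /tilt_mean [mu + _]addrC addrK qf_resid.
set b := (al - mu 0 i) / s2.
have -> : resid (b *: r) = 0.
  by rewrite -[b *: r]subr0 /resid !mxE -/s2 subr0 oppr0 addr0 mulfK// subrr.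
rewrite /qf !mul0mx [in X in _ + X]mxE addr0 !mxE -/s2 /b.
by field.
Qed.

(* Among the normal laws with a given [i]-th marginal, the tilted law minimizes
   the part of the divergence that does not depend on that marginal. *)
Lemma tilt_gap (a : 'rV[R]_n) (B : 'M[R]_n) : spd B ->
  let v := B i i in let al := a 0 i in
  let F (a : 'rV[R]_n) (B : 'M[R]_n) := - ln (\det B) + qf K (a - mu) + \tr (K *m B) in
  F a B <= F (tilt_mean al) (tilt_cov v) ->
  a = tilt_mean al /\ B = tilt_cov v.
Proof.
move=> hB v al F.
have v0 : 0 < v.
  case: hB => _ /(_ e); rewrite -rowE xe mxE eqxx mulr1n mxE; apply.
  apply/eqP => /rowP /(_ i); rewrite !mxE !eqxx /= => /eqP; by rewrite oner_eq0.
have [N NE [uN _]] := tilt_factor v0.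
(* [B] in coordinates that whiten the tilted law, so that [X = 1] means that [B] is the tilted
   covariance. *)
pose X := invmx N *m B *m (invmx N)^T.
have [L pL LE] := cholesky hB.
have XE : X = (invmx N *m L) *m (invmx N *m L)^T.
  by rewrite /X LE trmx_mul !mulmxA.
have uX : invmx N *m L \in unitmx by rewrite unitmx_mul unitmx_inv uN lower_pos_unit.
have sX : spd X by rewrite XE; exact: mulmx_tr_spd.
have dX : ln (\det X) = ln (\det B) - ln (\det (tilt_cov v)).
  have dB := spd_det hB; have dT := spd_det (tilt_spd v0).
  rewrite -ln_div ?posrE//; congr ln.
  rewrite /X NE !det_mulmx !det_tr det_inv.
  by field; rewrite -unitfE -unitmxE.
have trX : \tr X = \tr (K *m B) + 1 - v / s2.
  have -> : \tr X = \tr (invmx (tilt_cov v) *m B).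
    rewrite NE LE -frob_whiten// XE frob_tr; congr (\tr _).
  rewrite tilt_inv// mulmxDl linearD /= -scalemxAl linearZ /= -mulmxA [\tr (e^T *m _)]mxtrace_mulC.
  rewrite -[e *m B]rowE xe mxtrace_scalar mulr1n mxE -/v -addrA; congr (_ + _).
  by field; rewrite s2n gt_eqF.
have [h1 h2] := ln_det_trace sX.
have qE : qf K (a - mu) = (al - mu 0 i) ^+ 2 / s2 + qf K (resid (a - mu)).
  by rewrite qf_resid !mxE.
have sK : spd K.
  split=> // x x0; rewrite -/(qf K x).
  have [M pM ME] := cholesky hS.
  have uM := lower_pos_unit pM.
  rewrite /K ME -dot_whiten//.
  have := (mulmx_tr_spd (_ : 1%:M \in unitmx)).
  move=> /(_ R n (unitmx1 _ _)) [_ /(_ (x *m (invmx M)^T))].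
  rewrite trmx1 !mulmx1; apply.
  apply: contra_neq x0 => /(congr1 (mulmx^~ M^T)).
  by rewrite -mulmxA -trmx_mul mulmxV// trmx1 mulmx1 mul0mx.
(* The difference of the two values of [F] is [\tr X - n - ln (\det X)] plus the form at the
   residual; both are nonnegative, so both vanish. *)
rewrite /F tilt_qf tilt_trace qE => FF.
have q0 : 0 <= qf K (resid (a - mu)).
  have [->|x0] := eqVneq (resid (a - mu)) 0; first by rewrite /qf !mul0mx mxE.
  by rewrite ltW//; case: sK => _; apply.
split.
  have q1 : qf K (resid (a - mu)) = 0 by move: h1; rewrite dX trX; lra.
  have [x0|x0] := eqVneq (resid (a - mu)) 0; last first.
    by case: sK => _ /(_ _ x0); rewrite -/(qf K _) q1 ltxx.
  move/eqP: x0; rewrite /resid subr_eq0 => /eqP.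
  by rewrite !mxE /tilt_mean => <-; rewrite addrC subrK.
have : X = 1%:M by apply: h2; move: h1; rewrite dX trX; lra.
move=> /(congr1 (fun Y => N *m Y *m N^T)).
rewrite /X mulmx1 NE !mulmxA mulmxV// mul1mx => <-.
by rewrite -!mulmxA -trmx_mul mulmxV// trmx1 mulmx1.
Qed.

Lemma spd_precision : spd K.
Proof.
split=> // x x0.
have [_ /(_ (x *m K))] := hS.
have -> : x *m K *m Sigma *m (x *m K)^T = x *m K *m x^T.
  by rewrite mulmxKV// trmx_mul symK mulmxA.
apply; apply: contra_neq x0 => /(congr1 (mulmx^~ Sigma)).
by rewrite mulmxKV// mul0mx.
Qed.

(** The unnormalized conditional density of the other coordinates given the [i]-th, common to the
    prior and all its tilts. *)
Let D (m : 'rV[R]_n) := expR (- qf K (resid (m - mu)) / 2).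

Let mvn_split (a : 'rV[R]_n) (B : 'M[R]_n) v : 0 < v -> spd B ->
  (forall m, qf (invmx B) (m - a) = (m 0 i - a 0 i) ^+ 2 / v + qf K (resid (m - mu))) ->
  exists2 c, 0 < c & forall m,
    mvn_pdf a B m = c * normal_pdf (a 0 i) (Num.sqrt v) (m 0 i) * D m.
Proof.
move=> v0 sB h; have w0 : 0 < Num.sqrt v by rewrite sqrtr_gt0.
pose k : R := normal_pdf 0 1 0; have k0 : 0 < k := phi_gt0 0.
have phik u : normal_pdf 0 1 u = k * expR (- u ^+ 2 / 2).
  by rewrite /k !phiE expr0n oppr0 mul0r expR0 mulr1.
have p0 : 0 < Num.sqrt ((pi *+ 2) ^+ n * \det B).
  by rewrite sqrtr_gt0 mulr_gt0 ?spd_det// exprn_gt0// mulrn_wgt0// pi_gt0.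
exists (Num.sqrt v / k / Num.sqrt ((pi *+ 2) ^+ n * \det B)).
  by rewrite !divr_gt0.
move=> m; rewrite /mvn_pdf -/(qf (invmx B) (m - a)) h /D.
rewrite (normal_pdfE_phi _ _ w0) phik exprMn exprVn sqr_sqrtr ?ltW//.
rewrite opprD mulrDl expRD.
by field; rewrite !gt_eqF.
Qed.

Lemma mvn_factor : exists2 c, 0 < c & forall m,
  mvn_pdf mu Sigma m = c * normal_pdf (mu 0 i) (Num.sqrt s2) (m 0 i) * D m.
Proof.
by apply: mvn_split => // m; rewrite -/K qf_resid !mxE.
Qed.

Lemma tilt_pdf_factor al v : 0 < v -> exists2 c, 0 < c & forall m,
  mvn_pdf (tilt_mean al) (tilt_cov v) m = c * normal_pdf al (Num.sqrt v) (m 0 i) * D m.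
Proof.
move=> v0; have := @mvn_split (tilt_mean al) (tilt_cov v) v v0 (tilt_spd v0).
rewrite tilt_mean_coord; apply => m.
pose b := (al - mu 0 i) / s2.
have wE : m - tilt_mean al = (m - mu) - b *: r by rewrite opprD addrA.
have wi : (m - tilt_mean al) 0 i = m 0 i - al by rewrite mxE [X in _ + X]mxE tilt_mean_coord.
have -> : qf (invmx (tilt_cov v)) (m - tilt_mean al) =
    qf K (m - tilt_mean al) + (v^-1 - s2^-1) * (m 0 i - al) ^+ 2.
  rewrite tilt_inv// /qf mulmxDr mulmxDl mxE; congr (_ + _).
  rewrite -scalemxAr -scalemxAl mulmxA xe mul_scalar_mx -scalemxAl.
  rewrite -[e *m _]trmxK trmx_mul trmxK xe wi tr_scalar_mx !mxE eqxx mulr1n.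
  by rewrite -expr2.
rewrite qf_resid {2}wE resid_shift wi.
by field; rewrite s2n gt_eqF.
Qed.

(** The factor [D] is untouched by a factor in [m_i], so only the one-dimensional normal densities
    multiply; the tilted density being normalized, the constant drops out. *)
Lemma tilt_product m0 t al ta : 0 < t -> 0 < ta ->
  ta ^- 2 = s2^-1 + t ^- 2 -> al * ta ^- 2 = mu 0 i / s2 + m0 * t ^- 2 ->
  normalize (fun m => mvn_pdf mu Sigma m * normal_pdf m0 t (m 0 i)) =
  mvn_pdf (tilt_mean al) (tilt_cov (ta ^+ 2)).
Proof.
move=> t0 ta0 h1 h2.
have ss : Num.sqrt s2 ^+ 2 = s2 by rewrite sqr_sqrtr// ltW.
have [] := @normal_pdf_mul _ (mu 0 i) (Num.sqrt s2) m0 t al ta.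
- by rewrite sqrtr_gt0.
- by [].
- by [].
- by rewrite ss.
- by rewrite ss.
move=> c c0 cE.
have [c1 c10 E1] := mvn_factor.
have v0 : 0 < ta ^+ 2 by rewrite exprn_gt0.
have [c2 c20 E2] := tilt_pdf_factor al v0.
pose C := c1 * c / c2.
have C0 : 0 < C by rewrite divr_gt0 ?mulr_gt0.
have -> : (fun m => mvn_pdf mu Sigma m * normal_pdf m0 t (m 0 i)) =
    fun m => mvn_pdf (tilt_mean al) (tilt_cov (ta ^+ 2)) m * C.
  apply/funext => m; rewrite E1 E2 sqrtr_sqr gtr0_norm//.
  transitivity (c1 * (normal_pdf (mu 0 i) (Num.sqrt s2) (m 0 i) *
    normal_pdf m0 t (m 0 i)) * D m); first by ring.
  by rewrite cE /C; field; rewrite gt_eqF.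
apply/funext => m; rewrite /normalize.
have [L pL LE] := cholesky (tilt_spd v0).
have := @iint_gauss _ _ (tilt_mean al) L (fun=> C) C pL (hasE_cst n C).
by rewrite -LE => -> /=; rewrite mulfK// gt_eqF.
Qed.

(** Right multiplication by [Ei^T] deletes the [i]-th coordinate, by [Ei] inserts a zero in its
    place. *)
Let Ei : 'M[R]_(n.-1, n) := rowsub (lift i) 1%:M.

Let Ei_tr (x : 'rV[R]_n) j : (x *m Ei^T) 0 j = x 0 (lift i j).
Proof.
rewrite mxE (bigD1 (lift i j))//= !mxE eqxx mulr1 big1 ?addr0// => k kj.
by rewrite !mxE eq_sym (negbTE kj) mulr0.
Qed.

Let vinsK t (v : 'rV[R]_n.-1) : vins i t v *m Ei^T = v.
Proof. by apply/rowP => j; rewrite Ei_tr mxE liftK. Qed.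

Let EEt : Ei *m Ei^T = 1%:M.
Proof.
apply/row_matrixP => j; rewrite row_mul; apply/rowP => k.
by rewrite Ei_tr !mxE (inj_eq lift_inj).
Qed.

Let Ei_id (x : 'rV[R]_n) : x 0 i = 0 -> x *m Ei^T *m Ei = x.
Proof.
move=> x0; apply/rowP => k; rewrite mxE.
under eq_bigr do rewrite Ei_tr !mxE.
have [j ->|->] := unliftP i k.
  rewrite (bigD1 j)//= eqxx mulr1 big1 ?addr0// => l lj.
  by rewrite (inj_eq lift_inj) (negbTE lj) mulr0.
by rewrite big1 ?x0// => l _; rewrite eq_sym (negbTE (neq_lift _ _)) mulr0.
Qed.

(** With [m_i = t] fixed, [D] is an unnormalized normal density in the other coordinates whose
    covariance does not depend on [t]. Hence one [c] serves all [t] and both kinds of factor [g]. *)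
Lemma marg_mvn : exists2 c, 0 < c & forall (g : R -> R) t,
  marg i (fun m => mvn_pdf mu Sigma m * g (m 0 i)) t =
  c * (normal_pdf (mu 0 i) (Num.sqrt s2) t * g t).
Proof.
have [c1 c10 E1] := mvn_factor.
(* The conditional precision is the principal submatrix of [K] without index [i]. *)
pose K' := Ei *m K *m Ei^T.
have sK' : spd K'.
  have [_ pK] := spd_precision.
  split; first by rewrite /K' !trmx_mul trmxK symK mulmxA.
  move=> x x0; have := pK (x *m Ei).
  rewrite /K' trmx_mul !mulmxA; apply; apply: contra_neq x0 => /(congr1 (mulmx^~ Ei^T)).
  by rewrite -mulmxA EEt mulmx1 mul0mx.
have uK' := spd_unit sK'.
have sB : spd (invmx K').
  have [symK' pK'] := sK'.
  split; first by rewrite trmx_inv symK'.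
  move=> x x0; have := pK' (x *m invmx K').
  rewrite trmx_mul trmx_inv symK' mulmxKV// mulmxA; apply.
  apply: contra_neq x0 => /(congr1 (mulmx^~ K')); by rewrite mulmxKV// mul0mx.
pose q := Num.sqrt ((pi *+ 2) ^+ n.-1 * \det (invmx K')).
have q0 : 0 < q.
  by rewrite sqrtr_gt0 mulr_gt0 ?spd_det// exprn_gt0// mulrn_wgt0// pi_gt0.
exists (c1 * q); first by rewrite mulr_gt0.
move=> g t; rewrite /marg.
(* Conditional mean of the other coordinates given [m_i = t]. *)
pose ct := (mu + ((t - mu 0 i) / s2) *: r) *m Ei^T.
have vi v : vins i t v 0 i = t by rewrite mxE unlift_none.
pose w := c1 * q * (normal_pdf (mu 0 i) (Num.sqrt s2) t * g t).
have -> : (fun v => (mvn_pdf mu Sigma (vins i t v) * g (vins i t v 0 i))%:E) =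
    fun v => (mvn_pdf ct (invmx K') v * w)%:E.
  apply/funext => v; congr EFin; rewrite vi E1 vi /D.
  set d := resid _.
  have dE : d *m Ei^T = v - ct.
    have -> : d = vins i t v - mu - ((t - mu 0 i) / s2) *: r.
      by rewrite /d /resid; congr (_ - (_ / _) *: _); rewrite mxE [X in _ + X]mxE vi.
    rewrite !mulmxBl vinsK.
    by rewrite /ct mulmxDl opprD addrA.
  have -> : qf K d = qf K' (v - ct).
    have d0 : d 0 i = 0 by exact: resid_coord.
    rewrite -dE -{1}(Ei_id d0) /qf /K' [(d *m Ei^T *m Ei)^T]trmx_mul.
    by rewrite !mulmxA.
  rewrite /mvn_pdf invmxK -/(qf K' _) -/q /w.
  by field; rewrite gt_eqF.
have [L pL LE] := cholesky sB.
have := @iint_gauss _ _ ct L (fun=> w) w pL (hasE_cst _ w).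
by rewrite -LE => ->.
Qed.

End Tilt.

(** * Comparison of the two minimization problems *)

Section LocalGlobal.
Context {R : realType}.
Variables (J : R -> R -> R).
Hypothesis J_conv : forall a t a' t', 0 < t -> 0 < t' -> (a, t) <> (a', t') ->
  J ((a + a') / 2) ((t + t') / 2) < (J a t + J a' t') / 2.

(* Repeatedly halving the segment towards the constrained minimizer enters the
   open strip [t < s], where it would beat that minimizer. *)
Lemma midconvex_min_unique s a0 t0 a1 t1 : 0 < t0 < s -> 0 < t1 ->
  (forall a t, 0 < t < s -> J a0 t0 <= J a t) ->
  (forall a t, 0 < t -> J a1 t1 <= J a t) ->
  (a1, t1) = (a0, t0).
Proof.
move=> /andP[t00 t0s] t10 min0 min1; apply: contrapT => ne.
pose w k : R := 2^-1 ^+ k.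
have w0 k : 0 < w k by rewrite exprn_gt0// invr_gt0.
pose a k := a0 + w k * (a1 - a0); pose t k := t0 + w k * (t1 - t0).
have w1 k : w k <= 1 by rewrite exprn_ile1// ?invr_ge0// invf_le1// ler1n.
have tp k : 0 < t k.
  rewrite (_ : t k = (1 - w k) * t0 + w k * t1); last by rewrite /t; ring.
  by rewrite ltr_wpDl ?mulr_gt0// mulr_ge0 ?subr_ge0// ltW.
have nek k : (a0, t0) <> (a k, t k).
  move=> [ea et]; apply: ne.
  have za : w k * (a1 - a0) = 0 by move: ea; rewrite /a; lra.
  have zt : w k * (t1 - t0) = 0 by move: et; rewrite /t; lra.
  move/eqP: za; rewrite mulf_eq0 gt_eqF//= subr_eq0 => /eqP ->.
  by move/eqP: zt; rewrite mulf_eq0 gt_eqF//= subr_eq0 => /eqP ->.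
(* The next point is the midpoint of the current one and [(a0, t0)], so strict convexity applies. *)
have step k : J (a k) (t k) <= J a0 t0 -> J (a k.+1) (t k.+1) < J a0 t0.
  move=> h; have := J_conv t00 (tp k) (@nek k).
  have -> : (a0 + a k) / 2 = a k.+1 by rewrite /a /w exprS; field.
  have -> : (t0 + t k) / 2 = t k.+1 by rewrite /t /w exprS; field.
  by lra.
have all_le k : J (a k) (t k) <= J a0 t0.
  elim: k => [|k IH]; last exact/ltW/step.
  by rewrite /a /t /w expr0 !mul1r ![_ + (_ - _)]addrC !subrK; exact: min1.
have [k kP] : exists k, t k.+1 < s.
  have d0 : 0 < s - t0 by rewrite subr_gt0.
  have x0 : 0 <= t1 / (s - t0) by rewrite divr_ge0// ltW.
  (* As [2 ^+ N.+1] exceeds [t1 / (s - t0)], the weighted [t1] is below [s - t0], and the weight of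
     [t0] is less than one. *)
  exists (Num.bound (t1 / (s - t0))).
  have := archi_boundP x0; set N := Num.bound _ => hN.
  have {hN} hN : t1 / (s - t0) < 2 ^+ N.+1.
    by rewrite (lt_trans hN)// -natrX ltr_nat (ltn_trans (ltn_expl N (ltnSn 1)))// ltn_exp2l.
  have h : w N.+1 * t1 < s - t0.
    rewrite /w exprVn mulrC ltr_pdivrMr ?exprn_gt0//.
    by move: hN; rewrite ltr_pdivrMr// mulrC.
  have := mulr_gt0 (w0 N.+1) t00; rewrite /t; lra.
have := min0 (a k.+1) (t k.+1); rewrite tp kP => /(_ isT).
by rewrite leNgt step.
Qed.

End LocalGlobal.

(** * The one-dimensional objective and its strict midpoint convexity *)

Section Objective.
Context {R : realType}.
Variables (m0 s y : R).
Hypothesis s0 : 0 < s.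
Local Notation Phi := (@std_normal_cdf R).

Definition expected_nll (a t : R) := E1 (fun x => - ln (Phi (y * (a + t * x)))).

Definition objective (a t : R) :=
  - ln t + (((a - m0) / s) ^+ 2 + (t / s) ^+ 2) / 2 + expected_nll a t.

(** For each fixed [x] the argument of [Phi] is linear in [(a, t)], so midpoint concavity of
    [ln Phi] survives the expectation. *)
Lemma expected_nll_midconvex a t a' t' :
  expected_nll ((a + a') / 2) ((t + t') / 2) <= (expected_nll a t + expected_nll a' t') / 2.
Proof.
have T b u := tame_affine b u (tame_ln_cdf y).
rewrite [leRHS]mulrC; apply: (hasE1_le (T _ _) (hasE1Z 2^-1 (hasE1D (T a t) (T a' t')))) => x.
have := ln_cdf_midconcave (y * (a + t * x)) (y * (a' + t' * x)).
rewrite (_ : (y * (a + t * x) + y * (a' + t' * x)) / 2 = y * ((a + a') / 2 + (t + t') / 2 * x)); last by field.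
by lra.
Qed.

(** The quadratic terms supply strictness through the parallelogram identity; the other two terms
    are midpoint convex. *)
Lemma objective_midconvex a t a' t' : 0 < t -> 0 < t' -> (a, t) <> (a', t') ->
  objective ((a + a') / 2) ((t + t') / 2) < (objective a t + objective a' t') / 2.
Proof.
move=> t0 t0' ne.
have h1 := expected_nll_midconvex a t a' t'.
have h2 : ln t + ln t' <= 2 * ln ((t + t') / 2).
  have m : 0 < (t + t') / 2 by rewrite divr_gt0// addr_gt0.
  rewrite -lnM ?posrE// mulr_natl -lnXn// ler_ln ?posrE ?(mulr_gt0 t0 t0') ?(exprn_gt0 _ m)//.
  rewrite -subr_ge0 (_ : _ - _ = ((t - t') / 2) ^+ 2) ?sqr_ge0//.
  by field.
have h3 : 0 < ((a - a') / s) ^+ 2 + ((t - t') / s) ^+ 2.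
  have pos (u u' : R) : u != u' -> 0 < ((u - u') / s) ^+ 2.
    by move=> uu; rewrite exprn_even_gt0//= mulf_neq0 ?subr_eq0// invr_eq0 gt_eqF.
  have [ea|/pos pa] := eqVneq a a'; last by rewrite ltr_wpDr ?sqr_ge0.
  rewrite ltr_wpDl ?sqr_ge0//; apply: pos.
  by apply/eqP => et; apply: ne; rewrite ea et.
rewrite /objective.
have -> : (((a + a') / 2 - m0) / s) ^+ 2 = (((a - m0) / s) ^+ 2 + ((a' - m0) / s) ^+ 2) / 2
   - ((a - a') / s) ^+ 2 / 4 by field; rewrite gt_eqF.
have -> : ((t + t') / 2 / s) ^+ 2 = ((t / s) ^+ 2 + (t' / s) ^+ 2) / 2
   - ((t - t') / s) ^+ 2 / 4 by field; rewrite gt_eqF.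
move: h1 h2 h3; clear.
move: (expected_nll _ _) (expected_nll a t) (expected_nll a' t') => e e1 e2.
move: (ln _) (ln t) (ln t') => l l1 l2.
move: (((a - a') / s) ^+ 2) (((t - t') / s) ^+ 2) => A T.
move: (((a - m0) / s) ^+ 2) (((a' - m0) / s) ^+ 2) => A1 A2.
move: ((t / s) ^+ 2) ((t' / s) ^+ 2) => T1 T2.
by lra.
Qed.

End Objective.

(** Normalization cancels the constant of [marg_mvn], so the first argument is the normal density of
    the product. The objective is therefore expressed in the product parameters [al], [ta] instead
    of those of the factor. *)
Lemma KL1_marg (R : realType) n (mu : 'rV[R]_n) (Sigma : 'M[R]_n) (i : 'I_n) (y : R) :
  spd Sigma ->
  exists c, forall a t al ta, 0 < t -> 0 < ta ->
  ta ^- 2 = (Sigma i i)^-1 + t ^- 2 -> al * ta ^- 2 = mu 0 i / Sigma i i + a * t ^- 2 ->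
  KL1 (normalize1 (marg i (fun m => mvn_pdf mu Sigma m * normal_pdf a t (m 0 i))))
      (normalize1 (marg i (fun m => mvn_pdf mu Sigma m * std_normal_cdf (y * m 0 i)))) =
  (c + objective (mu 0 i) (Num.sqrt (Sigma i i)) y al ta)%:E.
Proof.
move=> hS; have s20 := spd_diag_gt0 i hS.
have s0 : 0 < Num.sqrt (Sigma i i) by rewrite sqrtr_gt0.
have [c1 c10 mE] := marg_mvn mu i hS.
set s := Num.sqrt _ in s0 mE *.
have ss : s ^+ 2 = Sigma i i by rewrite sqr_sqrtr// ltW.
pose g x := @std_normal_cdf R (y * x).
have tg : tame g := tame_cdf y.
have tlg : tame (fun x => - ln (g x)) := tame_ln_cdf y.
have g0 x : 0 < g x by exact: cdf_gt0.
pose Z := E1 (fun x => g (mu 0 i + s * x)).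
have Z0 : 0 < Z := E1_affine_gt0 g0 tg _ _.
exists (ln s + ln Z - 2^-1) => a t al ta t0 ta0 h1 h2.
rewrite -ss in h1 h2.
have [c c0 cE] := normal_pdf_mul s0 t0 ta0 h1 h2.
have -> : normalize1 (marg i (fun m => mvn_pdf mu Sigma m * normal_pdf a t (m 0 i))) =
    normal_pdf al ta.
  rewrite (_ : marg i _ = fun x => (c1 * c) * normal_pdf al ta x); last first.
    by apply/funext => x; rewrite (mE (normal_pdf a t)) cE mulrA.
  rewrite (@normalize1_scale _ _ 1) ?mulr_gt0//.
  - by apply/funext => x; rewrite divr1.
  - exact: measurable_normal_pdf.
  - by move=> x; exact: normal_pdf_ge0.
  - exact: integral_normal_pdf.
have -> : normalize1 (marg i (fun m => mvn_pdf mu Sigma m * std_normal_cdf (y * m 0 i))) =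
    fun x => normal_pdf (mu 0 i) s x * g x / Z.
  rewrite (_ : marg i _ = fun x => c1 * (normal_pdf (mu 0 i) s x * g x)); last first.
    by apply/funext => x; rewrite (mE g).
  apply: normalize1_scale => //.
  - by apply: measurable_funM; [exact: measurable_normal_pdf|case: tg].
  - by move=> x; rewrite mulr_ge0 ?normal_pdf_ge0 ?ltW.
  - exact: integral_normal_tame.
rewrite (KL1_normal (mu 0 i) al g0 tlg s0 ta0 Z0); congr EFin.
by rewrite /objective /expected_nll /g; ring.
Qed.

Theorem theorem1 (R : realType) (n : nat) (hn : (1 <= n)%N)
  (mu : 'rV[R]_n) (Sigma : 'M[R]_n) (hSigma : spd Sigma)
  (i : 'I_n) (y : R) (hy : y = 1 \/ y = -1)
  (muc : 'rV[R]_n) (Sigmac : 'M[R]_n)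
  (hc : spd Sigmac /\
        forall (a : 'rV[R]_n) (B : 'M[R]_n), spd B ->
          (KL (normalize (mvn_pdf muc Sigmac))
              (normalize (fun m => (mvn_pdf mu Sigma m * std_normal_cdf (y * m 0 i))%R)) <=
           KL (normalize (mvn_pdf a B))
              (normalize (fun m => (mvn_pdf mu Sigma m * std_normal_cdf (y * m 0 i))%R)))%E)
  (mut s2t : R)
  (ht : 0 < s2t /\
        forall (a s2 : R), 0 < s2 ->
          (KL1 (normalize1 (marg i (fun m => (mvn_pdf mu Sigma m *
                                      normal_pdf mut (Num.sqrt s2t) (m 0 i))%R)))
               (normalize1 (marg i (fun m => (mvn_pdf mu Sigma m *
                                      std_normal_cdf (y * m 0 i))%R))) <=
           KL1 (normalize1 (marg i (fun m => (mvn_pdf mu Sigma m *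
                                      normal_pdf a (Num.sqrt s2) (m 0 i))%R)))
               (normalize1 (marg i (fun m => (mvn_pdf mu Sigma m *
                                      std_normal_cdf (y * m 0 i))%R))))%E) :
  forall m : 'rV[R]_n,
    mvn_pdf muc Sigmac m =
    normalize (fun m' => mvn_pdf mu Sigma m' * normal_pdf mut (Num.sqrt s2t) (m' 0 i)) m.
Proof.
case: hc => sSc hc; case: ht => s2t0 ht.
have q0 := spd_diag_gt0 i hSigma; set q := Sigma i i in q0.
have qn : q != 0 by rewrite gt_eqF.
have s0 : 0 < Num.sqrt q by rewrite sqrtr_gt0.
have ss : Num.sqrt q ^+ 2 = q by rewrite sqr_sqrtr// ltW.
have [c KLE] := KL_mvn_trace mu i (fun x => cdf_gt0 (y * x)) (tame_cdf y) (tame_ln_cdf y) hSigma.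
have [c' KL1E] := KL1_marg mu i y hSigma.
pose al := muc 0 i; pose v := Sigmac i i.
have v0 : 0 < v := spd_diag_gt0 i sSc.
pose J := objective (mu 0 i) (Num.sqrt q) y.
(* The competitor is the tilt with the same [i]-th marginal: the expected likelihood terms agree and
   only the functional of [tilt_gap] is compared. *)
have [mucE ScE] : muc = tilt_mean mu Sigma i al /\ Sigmac = tilt_cov Sigma i v.
  apply: (tilt_gap hSigma sSc).
  have := hc (tilt_mean mu Sigma i al) (tilt_cov Sigma i v) (tilt_spd i hSigma v0).
  rewrite (KLE _ _ sSc) (KLE _ _ (tilt_spd i hSigma v0)) lee_fin.
  rewrite (tilt_mean_coord mu i hSigma) (tilt_cov_diag i hSigma) -/al -/v.
  move: (E1 _) (ln (\det Sigmac)) (ln _) (qf _ _) (qf _ _) (\tr _) (\tr _) => *; lra.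
have KT a u : 0 < u ->
    KL (normalize (mvn_pdf (tilt_mean mu Sigma i a) (tilt_cov Sigma i u)))
       (normalize (fun m => (mvn_pdf mu Sigma m * std_normal_cdf (y * m 0 i))%R)) =
    (c + (ln q - ln (\det Sigma) + n%:R - 1) / 2 + J a (Num.sqrt u))%:E.
  move=> u0; have dS := spd_det hSigma; have su0 : 0 < Num.sqrt u by rewrite sqrtr_gt0.
  rewrite (KLE _ _ (tilt_spd i hSigma u0)); congr EFin.
  rewrite (tilt_mean_coord mu i hSigma) (tilt_cov_diag i hSigma) (tilt_det i hSigma u0).
  rewrite (tilt_qf mu i hSigma) (tilt_trace i hSigma) -/q /J /objective /expected_nll.
  rewrite lnM ?posrE ?divr_gt0// ln_div ?posrE//.
  have -> : ln u = 2 * ln (Num.sqrt u).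
    by rewrite -[in LHS](sqr_sqrtr (ltW u0)) lnXn// mulr_natl.
  rewrite !exprMn !exprVn ss (sqr_sqrtr (ltW u0)).
  move: (E1 _) (ln (Num.sqrt u)) (ln q) (ln (\det Sigma)) => e1 e2 e3 e4.
  by field.
have min1 a t : 0 < t -> J al (Num.sqrt v) <= J a t.
  move=> t0; have t20 : 0 < t ^+ 2 by rewrite exprn_gt0.
  have := hc (tilt_mean mu Sigma i a) (tilt_cov Sigma i (t ^+ 2)) (tilt_spd i hSigma t20).
  rewrite (KT _ _ t20) mucE ScE (KT _ _ v0) lee_fin lerD2l.
  by rewrite sqrtr_sqr gtr0_norm.
(* Here [t] is the variance of the factor, whereas [KL1_marg] takes standard deviations. *)
have rel a t al' ta : 0 < t -> 0 < ta -> ta ^+ 2 = q * t / (q + t) ->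
    al' = ta ^+ 2 * (mu 0 i / q + a / t) ->
    [/\ ta ^- 2 = q^-1 + Num.sqrt t ^- 2 & al' * ta ^- 2 = mu 0 i / q + a * Num.sqrt t ^- 2].
  move=> t0 ta0 e1 e2; rewrite (sqr_sqrtr (ltW t0)).
  have n1 : ta ^+ 2 != 0 by rewrite gt_eqF ?exprn_gt0.
  split; last by rewrite e2 mulrAC divff// mul1r.
  by rewrite e1; field; rewrite !gt_eqF ?addr_gt0.
pose ta0 := Num.sqrt (q * s2t / (q + s2t)).
have ta00 : 0 < ta0 by rewrite sqrtr_gt0 divr_gt0 ?mulr_gt0 ?addr_gt0.
have ta0E : ta0 ^+ 2 = q * s2t / (q + s2t).
  by rewrite sqr_sqrtr// ltW// divr_gt0 ?mulr_gt0 ?addr_gt0.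
pose al0 := ta0 ^+ 2 * (mu 0 i / q + mut / s2t).
have [r1 r2] := rel mut s2t al0 ta0 s2t0 ta00 ta0E erefl.
have w0 : 0 < Num.sqrt s2t by rewrite sqrtr_gt0.
have ta0s : ta0 < Num.sqrt q.
  rewrite ltr_sqrt// ltr_pdivrMr ?addr_gt0//.
  by have := mulr_gt0 q0 q0; lra.
have min0 a t : 0 < t < Num.sqrt q -> J al0 ta0 <= J a t.
  move=> /andP[t0 ts].
  have tq : t ^+ 2 < q by rewrite -ss ltr_pXn2r ?nnegrE ?ltW.
  have d0 : 0 < q - t ^+ 2 by rewrite subr_gt0.
  have t20 : 0 < t ^+ 2 by rewrite exprn_gt0.
  (* The factor variance solving [1 / t ^+ 2 = 1 / q + 1 / u]; it is positive because [t] lies in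
     the strip. Likewise [b] is the factor mean that produces [a]. *)
  pose u := q * t ^+ 2 / (q - t ^+ 2).
  have u0 : 0 < u by rewrite divr_gt0 ?mulr_gt0.
  pose b := u * (a / t ^+ 2 - mu 0 i / q).
  have e1 : t ^+ 2 = q * u / (q + u).
    by rewrite /u; field; rewrite -mulrDr subrK mulf_neq0 ?gt_eqF.
  have e2 : a = t ^+ 2 * (mu 0 i / q + b / u).
    by rewrite /b; field; rewrite !gt_eqF.
  have [r3 r4] := rel b u a t u0 t0 e1 e2.
  have su0 : 0 < Num.sqrt u by rewrite sqrtr_gt0.
  have k1 := KL1E mut (Num.sqrt s2t) al0 ta0 w0 ta00 r1 r2.
  have k2 := KL1E b (Num.sqrt u) a t su0 t0 r3 r4.
  have := etrans (esym (congr2 (fun A B => (A <= B)%E) k1 k2)) (ht b u u0).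
  by rewrite lee_fin lerD2l.
have ta0I : 0 < ta0 < Num.sqrt q by rewrite ta00.
have sv0 : 0 < Num.sqrt v by rewrite sqrtr_gt0.
have [alE svE] := midconvex_min_unique (objective_midconvex (mu 0 i) y s0) ta0I sv0 min0 min1.
move=> m; rewrite (tilt_product hSigma w0 ta00 r1 r2) -alE -svE sqr_sqrtr ?ltW//.
by rewrite -mucE -ScE.
Qed.
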